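(* Let $\ell\ge 1$ and let $\mathbf{A}$ be a mask of dimension $2$ satisfying the spectral condition, such that its Taylor scheme (the vector subdivision scheme with mask $\partial_t\mathbf{A}$) is $C^{\ell-1}$ and all limit functions of the Taylor scheme have vanishing first component, for all input data. Define $\mathbf{B}=\widetilde{\mathcal{I}_1(\partial_t\mathbf{A})}$ and $\mathbf{C}=\mathcal{I}_t(\mathbf{B})$. Then $\mathbf{C}$ is a (well-defined, finitely supported) mask satisfying the spectral condition, and the Hermite subdivision scheme associated with $\mathbf{C}$ is $HC^{\ell+1}$ convergent.
   Context: All masks here are finitely supported sequences $\mathbf{A}=\{A_i\in\mathbb{R}^{2\times2}: i\in\mathbb{Z}\}$ with symbol $\mathbf{A}^*(z)=\sum_iA_iz^i$ and scalar entries $\boldsymbol{\alpha}_{ij}$ (symbols $\boldsymbol{\alpha}_{ij}^*(z)$). $(S_{\mathbf{A}}c)_i=\sum_{j}A_{i-2j}c_j$. For invertible $R$, $R^{-1}\mathbf{A}R=\{R^{-1}A_iR\}$. Vector scheme: $c^n=S_{\mathbf{A}}^nc^0$. It is convergent ($C^0$) if for every $c^0\in\ell^\infty(\mathbb{R}^2)$ there is a continuous $\Psi:\mathbb{R}\to\mathbb{R}^2$ (the limit function) with $\sup_i\|c_i^n-\Psi(i/2^n)\|\to0$, and $\Psi\neq0$ for some $c^0$; it is $C^\ell$ if moreover all $\Psi$ are $\ell$ times continuously differentiable. Hermite scheme: $D^nc^n=S_{\mathbf{A}}^nc^0$ with $D=\mathrm{diag}(1,\frac12)$. It is $HC^\ell$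 convergent ($\ell\ge1$) if for every $c^0\in\ell^\infty(\mathbb{R}^2)$ there is $\Psi=(\Psi^0,\Psi^1)^T$ with $\Psi^0\in C^\ell(\mathbb{R},\mathbb{R})$ and $\Psi^1=(\Psi^0)'$ such that $c^n=D^{-n}S_{\mathbf{A}}^nc^0$ satisfies $\sup_i\|c^n_i-\Psi(i/2^n)\|\to0$. Spectral condition: there is $\varphi\in\mathbb{R}$ such that the sequences $\mathbf{k}=\{(1,0)^T: i\in\mathbb{Z}\}$ and $\boldsymbol{\ell}=\{(i+\varphi,1)^T:i\in\mathbb{Z}\}$ satisfy $S_{\mathbf{A}}\mathbf{k}=\mathbf{k}$ and $S_{\mathbf{A}}\boldsymbol{\ell}=\frac12\boldsymbol{\ell}$. Taylor operator: $T=\begin{pmatrix}\Delta&-1\\0&1\end{pmatrix}$, where $(\Delta c)_i=c_{i+1}-c_i$. For $\mathbf{A}$ satisfying the spectral condition, $\partial_t\mathbf{A}$ is the (unique) mask with $TS_{\mathbf{A}}=\frac12S_{\partial_t\mathbf{A}}T$. Taylor conditions on a mask $\mathbf{B}$ with entries $\boldsymbol{\beta}_{ij}$: $\boldsymbol{\beta}_{12}^*(1)=\boldsymbol{\beta}_{12}^*(-1)=0$; $\boldsymbol{\beta}_{22}^*(1)=2$, $\boldsymbol{\beta}_{22}^*(-1)=0$; $\boldsymbol{\beta}_{11}^*(1)+\boldsymbol{\beta}_{21}^*(1)=2$. For $\mathbf{B}$ satisfying the Taylor conditions, $\mathcal{I}_t\mathbf{B}$ is the (unique) mask with $TS_{\mathcal{I}_t\mathbf{B}}=\frac12S_{\mathbf{B}}T$.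 Put $B^0=\sum_iB_{2i}$, $B^1=\sum_iB_{2i+1}$, $M_{\mathbf{B}}=\frac12(B^0+B^1)$, $\mathcal{E}_{\mathbf{B}}=\{v\in\mathbb{R}^2:B^0v=B^1v=v\}$. Operator $\mathcal{I}_1$: for a mask $\mathbf{B}$ of a convergent vector scheme with $\dim\mathcal{E}_{\mathbf{B}}=1$, take a canonical transformation $\overline{R}=[v\,|\,q]$ ($v$ spans $\mathcal{E}_{\mathbf{B}}$, $q$ spans the invariant space of $M_{\mathbf{B}}$ belonging to the eigenvalue different from $1$), let $\overline{\mathbf{B}}=\overline{R}^{-1}\mathbf{B}\overline{R}$ with entries $\overline{\boldsymbol{\beta}}_{ij}$, and let $\mathcal{I}_1\mathbf{B}=\overline{R}\,\overline{\mathbf{A}}\,\overline{R}^{-1}$ with $$\overline{\mathbf{A}}^*(z)=\frac12\begin{pmatrix}(z^{-1}+1)\overline{\boldsymbol{\beta}}_{11}^*(z)&\overline{\boldsymbol{\beta}}_{12}^*(z)/(z^{-1}-1)\\(z^{-2}-1)\overline{\boldsymbol{\beta}}_{21}^*(z)&\overline{\boldsymbol{\beta}}_{22}^*(z)\end{pmatrix}.$$ (The result does not depend on the choice of $\overline{R}$.) Tilde transformation: for a mask $\mathbf{B}$ with $a=\boldsymbol{\beta}_{11}^*(1)\ne2$ and $b=\boldsymbol{\beta}_{21}^*(1)$, $\widetilde{\mathbf{B}}=\mathcal{R}^{-1}\mathbf{B}\mathcal{R}$ with $\mathcal{R}=\begin{pmatrix}1&0\\\eta&1\end{pmatrix}$,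 $\eta=1+\frac{b}{a-2}$. (Under the hypotheses on $\mathbf{A}$ one has $\mathcal{E}_{\partial_t\mathbf{A}}=\operatorname{span}\{e_2\}$, so that $\mathcal{I}_1(\partial_t\mathbf{A})$ is meaningful.) *)

(* Defs.v *)
From HB Require Import structures.
From mathcomp Require Import all_boot all_order all_algebra.
From mathcomp Require Import all_classical all_reals all_analysis.

Set Implicit Arguments.
Unset Strict Implicit.
Unset Printing Implicit Defensive.

Import Order.TTheory GRing.Theory Num.Theory.
Import numFieldNormedType.Exports.

Local Open Scope classical_set_scope.
Local Open Scope ring_scope.

(* Components and matrix entries are numbered 0, 1 here; in the usual          *)
(* mathematical notation they are numbered 1, 2.                               *)

Section Subdivision.
Variable R : realType.

Definition mx22 (a b c d : R) : 'M[R]_2 :=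
  \matrix_(i, j) if i == 0 then (if j == 0 then a else b)
                 else (if j == 0 then c else d).

Definition vec2 (a b : R) : 'cV[R]_2 := \col_i if i == 0 then a else b.

Definition vseq := int -> 'cV[R]_2.
Definition mseq := int -> 'M[R]_2.

Definition is_mask (A : mseq) : Prop := finite_set [set i | A i != 0].

Definition entry (A : mseq) (i j : 'I_2) : int -> R := fun k => A k i j.

(* The value at z of the Laurent polynomial with coefficients a. An identity   *)
(* between Laurent polynomials, or between rational functions, is expressed    *)
(* by its validity at all real z outside a finite set.                         *)
Definition symbol (a : int -> R) (z : R) : R := \sum_(i \in [set: int]) a i * z ^ i.

Definition mxsymbol (A : mseq) (z : R) : 'M[R]_2 :=
  \matrix_(i, j) symbol (entry A i j) z.

Definition conj_mask (Q : 'M[R]_2) (A : mseq) : mseq :=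
  fun k => invmx Q *m A k *m Q.

(* For a mask A the set of j with nonzero summand is finite, for any c.        *)
Definition subdiv (A : mseq) (c : vseq) : vseq :=
  fun i => \sum_(j \in [set: int]) A (i - 2 * j) *m c j.

Definition Ck (k : nat) (V : normedModType R) (f : R -> V) : Prop :=
  (forall j x, (j < k)%N -> derivable (derive1n j f) x 1) /\
  continuous (derive1n k f).

Definition converges_to (c : nat -> vseq) (Psi : R -> 'cV[R]_2) : Prop :=
  ereal_sup [set `|c n i - Psi (i%:~R / 2 ^+ n)|%:E | i in [set: int]]
    @[n --> \oo] --> 0%E.

Definition vector_limit (A : mseq) (c0 : vseq) (Psi : R -> 'cV[R]_2) : Prop :=
  continuous Psi /\ converges_to (fun n => iter n (subdiv A) c0) Psi.

Definition vector_convergent (A : mseq) : Prop :=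
  (forall c0 : vseq, bounded_fun c0 -> exists Psi, vector_limit A c0 Psi) /\
  (exists (c0 : vseq) (Psi : R -> 'cV[R]_2),
     [/\ bounded_fun c0, vector_limit A c0 Psi & Psi <> cst 0]).

Definition vector_Ck (k : nat) (A : mseq) : Prop :=
  vector_convergent A /\
  (forall (c0 : vseq) (Psi : R -> 'cV[R]_2),
     bounded_fun c0 -> vector_limit A c0 Psi -> Ck k Psi).

Definition hermiteD : 'M[R]_2 := mx22 1 0 0 2^-1.

Definition hermite_iter (A : mseq) (c0 : vseq) (n : nat) : vseq :=
  fun i => hermiteD ^- n *m iter n (subdiv A) c0 i.

(* Meant for 1 <= k.                                                           *)
Definition HCk (k : nat) (A : mseq) : Prop :=
  forall c0 : vseq, bounded_fun c0 ->
  exists Psi0 : R -> R, Ck k (Psi0 : R -> R^o) /\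
    converges_to (hermite_iter A c0)
      (fun x => vec2 (Psi0 x) (derive1 (Psi0 : R -> R^o) x)).

Definition spectral_condition (A : mseq) : Prop :=
  exists phi : R,
    let k : vseq := fun=> vec2 1 0 in
    let l : vseq := fun i => vec2 (i%:~R + phi) 1 in
    subdiv A k = k /\ subdiv A l = (fun i => 2^-1 *: l i).

Definition taylor (c : vseq) : vseq :=
  fun i => vec2 (c (i + 1) 0 0 - c i 0 0 - c i 1 0) (c i 1 0).

(* The operators on masks below are partial: each is given by a predicate      *)
(* "spec B X" (B is in the domain and X is the result), and by the function    *)
(* that picks the result, with value 0 outside the domain.                     *)

(* T S_A = 1/2 S_B T *)
Definition taylor_factor (A B : mseq) : Prop :=
  forall c : vseq, taylor (subdiv A c) = fun i => 2^-1 *: subdiv B (taylor c) i.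

Definition dt_spec (A X : mseq) : Prop :=
  [/\ is_mask A, spectral_condition A, is_mask X & taylor_factor A X].

Definition dt (A : mseq) : mseq := xget (fun=> 0) [set X | dt_spec A X].

Definition taylor_conditions (B : mseq) : Prop :=
  [/\ symbol (entry B 0 1) 1 = 0 /\ symbol (entry B 0 1) (-1) = 0,
      symbol (entry B 1 1) 1 = 2 /\ symbol (entry B 1 1) (-1) = 0 &
      symbol (entry B 0 0) 1 + symbol (entry B 1 0) 1 = 2].

Definition It_spec (B X : mseq) : Prop :=
  [/\ is_mask B, taylor_conditions B, is_mask X & taylor_factor X B].

Definition It (B : mseq) : mseq := xget (fun=> 0) [set X | It_spec B X].

Definition even_sum (B : mseq) : 'M[R]_2 := \sum_(i \in [set: int]) B (2 * i).
Definition odd_sum (B : mseq) : 'M[R]_2 := \sum_(i \in [set: int]) B (2 * i + 1).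
Definition mean_mx (B : mseq) : 'M[R]_2 := 2^-1 *: (even_sum B + odd_sum B).

Definition mxend (M : 'M[R]_2) : 'End('cV[R]_2) := linfun (mulmx M).

Definition Espace (B : mseq) : {vspace 'cV[R]_2} :=
  (fixedSpace (mxend (even_sum B)) :&: fixedSpace (mxend (odd_sum B)))%VS.

(* As the eigenvalue lambda differs from 1, which is an eigenvalue too when    *)
(* Espace B is a line, its invariant space is its eigenspace.                  *)
Definition canonical_transformation (B : mseq) (Q : 'M[R]_2) : Prop :=
  exists v q : 'cV[R]_2,
    [/\ Q = row_mx v q, Espace B = <[v]>%VS, q != 0 &
        exists2 lambda : R, lambda != 1 &
          passmx.leigenspace (mxend (mean_mx B)) lambda = <[q]>%VS].

Definition I1_spec (B X : mseq) : Prop :=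
  [/\ is_mask B, vector_convergent B, (\dim (Espace B) = 1)%N &
      exists (Q : 'M[R]_2) (Abar : mseq),
        [/\ canonical_transformation B Q, is_mask Abar,
            X = conj_mask (invmx Q) Abar &
            let b i j := symbol (entry (conj_mask Q B) i j) in
            forall z : R, z != 0 -> z != 1 ->
              mxsymbol Abar z = 2^-1 *:
                mx22 ((z^-1 + 1) * b 0 0 z)      (b 0 1 z / (z^-1 - 1))
                     ((z ^- 2 - 1) * b 1 0 z)    (b 1 1 z)]].

Definition I1 (B : mseq) : mseq := xget (fun=> 0) [set X | I1_spec B X].

Definition tilde_dom (B : mseq) : Prop := symbol (entry B 0 0) 1 != 2.

Definition tilde (B : mseq) : mseq :=
  let a := symbol (entry B 0 0) 1 in
  let b := symbol (entry B 1 0) 1 in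
  conj_mask (mx22 1 0 (1 + b / (a - 2)) 1) B.

End Subdivision.

(* Main.v *)
Require Import Defs.
From mathcomp Require Import all_boot all_order all_algebra.
From mathcomp Require Import all_classical all_reals all_analysis.
From mathcomp Require Import zify ring lra.

Set Implicit Arguments.
Unset Strict Implicit.
Unset Printing Implicit Defensive.

Import Order.TTheory GRing.Theory Num.Theory.
Import numFieldNormedType.Exports.

Local Open Scope classical_set_scope.
Local Open Scope ring_scope.

(** Let V be the Taylor mask of A.  Its limit functions have the form (0, psi)
with psi of class C^(l-1), and the theorem says that integrating psi twice gives
the limits of a Hermite scheme.

Limits take their values in the common fixed space of the even and odd sums of V;
as their first component vanishes, this space is the line of the second basis
vector ([Espace_vanish]).  Summing the iterates of a delta sequence shows that the
upper left entry a of the sum of V satisfies |a| < 2 ([contractive_corner]), so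
the sum of V is diagonalised by a unipotent lower triangular matrix W.  Put
V' = W^-1 V W.  In the same coordinates, whatever canonical transformation is
chosen, I1 V is the mask X with L S_X = 1/2 S_V' L, where L = diag(1, Delta)
([I1_specP]); uniqueness of I1 V follows.  The mask B = tilde (I1 V) is again a
lower triangular conjugate of X, and the tilde transformation is exactly what
makes it satisfy the Taylor conditions ([transformed_masks]).  These allow one to
solve T S_C = 1/2 S_B T for a mask C ([It_exists]), which is unique because T is
injective on finitely supported sequences.

Consequently, up to constant changes of basis, L and T map the iterates of C to
4^-n times iterates of V, and the convergence of C is recovered by two discrete
integrations: of the second component for X, then of the first one for C.  In each
of them 2^n times the differences converge uniformly to a known continuous
function while the other component is O(2^-n); since the even and odd sums
reproduce constants in the integrated component, this component then converges
uniformly to a primitive of that function ([integrated_component], which rests on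
[integration]).  With psi in C^(l-1) the limits are thus C^l for X, hence for B,
and C^(l+1) for C.

Uniformity over all integers needs the iterates of V to be bounded independently
of n.  Convergence of the scheme does not contain this, as limit functions are not
assumed bounded; it follows from the compact support of the limits of delta
sequences ([scheme_bounded]). *)

(** * Finitely supported sequences on the integers *)

(** Finite supports are enclosed in a symmetric interval, so that all finite sums
become sums over one explicit duplicate-free sequence. *)
Definition supp (V : zmodType) (N : nat) (f : int -> V) :=
  forall i, (N < absz i)%N -> f i = 0.

Definition fsupp (V : zmodType) (f : int -> V) := exists N, supp N f.

Definition window (N : nat) : seq int := [seq k%:Z - N%:Z | k <- iota 0 N.*2.+1].

Lemma mem_window N i : (i \in window N) = (absz i <= N)%N.
Proof.
apply/mapP/idP => [[k]|iN]; first by rewrite mem_iota => kN ->; lia.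
by exists (absz (i + N%:Z)); rewrite ?mem_iota; lia.
Qed.

Lemma uniq_window N : uniq (window N).
Proof. by rewrite map_inj_uniq ?iota_uniq// => a b; lia. Qed.

Lemma fsuppP (V : zmodType) (f : int -> V) :
  finite_set [set i | f i != 0] <-> fsupp f.
Proof.
split=> [/finite_seqP[s fs]|[N fN]].
  exists (\max_(i <- s) absz i)%N => i iN; apply/eqP/negPn/negP => fi.
  have : i \in s by have : [set i | f i != 0] i by []; rewrite fs.
  by move=> si; have := @leq_bigmax_seq _ s xpredT absz i si isT; lia.
apply: (@sub_finite_set _ _ [set` window N]); last exact: finite_seq.
move=> i /= fi; rewrite mem_window leqNgt; apply/negP => /fN /eqP.
by rewrite (negPf fi).
Qed.

Notation fsum f := (\sum_(i \in [set: int]) f i).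

Lemma fsum_window (V : zmodType) (f : int -> V) N : supp N f ->
  fsum f = \sum_(i <- window N) f i.
Proof.
move=> fN; rewrite (fsbig_seq _ _ (uniq_window N)); apply/esym/fsbig_widen => //.
move=> i /= [_]; rewrite mem_window => iN; apply: fN; lia.
Qed.

Lemma fsum_single (V : zmodType) (f : int -> V) i0 : (forall i, i != i0 -> f i = 0) ->
  fsum f = f i0.
Proof.
move=> f0; rewrite -[RHS](@fsbig_set1 V 0 +%R).
by apply/esym/fsbig_widen => // i /= [_ /eqP]; apply: f0.
Qed.

Lemma supp_le (V : zmodType) (f : int -> V) N M : (N <= M)%N -> supp N f -> supp M f.
Proof. by move=> NM fN i iM; apply: fN; lia. Qed.

(** Meant for affine reindexings such as j |-> i - 2 j, which decrease absolute
values by at most a constant. *)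
Lemma fsupp_comp (V W : zmodType) (f : int -> V) (h : int -> int) (g : int -> V -> W) K :
  (forall i, absz i <= absz (h i) + K)%N -> (forall i, g i 0 = 0) ->
  fsupp f -> fsupp (fun i => g i (f (h i))).
Proof.
move=> hK g0 [N fN]; exists (N + K)%N => i iNK; rewrite fN//.
have := hK i; lia.
Qed.

Lemma fsupp_map (V W : zmodType) (f : int -> V) (g : int -> V -> W) :
  (forall i, g i 0 = 0) -> fsupp f -> fsupp (fun i => g i (f i)).
Proof. by move=> g0; apply: (fsupp_comp (h := id) (K := 0%N)) => // i; lia. Qed.

Lemma fsupp_shift (V : zmodType) (f : int -> V) m : fsupp f -> fsupp (fun i => f (i + m)).
Proof. by apply: (fsupp_comp (g := fun=> id) (K := absz m)) => // i; lia. Qed.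

Lemma fsuppD (V : zmodType) (f g : int -> V) : fsupp f -> fsupp g ->
  fsupp (fun i => f i + g i).
Proof.
move=> [N fN] [M gM]; exists (maxn N M) => i iNM.
by rewrite fN ?gM ?addr0//; lia.
Qed.

Lemma fsumD (V : zmodType) (f g : int -> V) : fsupp f -> fsupp g ->
  fsum (fun i => f i + g i) = fsum f + fsum g.
Proof.
move=> [N fN] [M gM].
have {}fN := supp_le (leq_maxl N M) fN; have {}gM := supp_le (leq_maxr N M) gM.
rewrite (fsum_window fN) (fsum_window gM) -big_split.
by apply: fsum_window => i iNM; rewrite fN// gM// addr0.
Qed.

Lemma fsum_morph (V W : zmodType) (f : int -> V) (phi : V -> W) :
  {morph phi : x y / x + y} -> fsupp f ->
  fsum (fun i => phi (f i)) = phi (fsum f).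
Proof.
move=> phiD [N fN].
have phi0 : phi 0 = 0 by apply: (addrI (phi 0)); rewrite -phiD !addr0.
rewrite (fsum_window fN) (big_morph phi phiD phi0); apply: fsum_window => i iN.
by rewrite fN.
Qed.

Lemma fsumZ (R : pzRingType) (f : int -> R) (x : R) : fsupp f ->
  fsum (fun i => x * f i) = x * fsum f.
Proof. by apply: fsum_morph => a b; rewrite mulrDr. Qed.

Lemma fsum_reindex (V : zmodType) (f : int -> V) (h : int -> int) :
  bijective h -> fsum f = fsum (fun i => f (h i)).
Proof. exact: reindex_fsbigT. Qed.

Lemma shift_bij (m : int) : bijective (fun i : int => i + m).
Proof. by exists (fun i => i - m) => i; rewrite ?addrK ?subrK. Qed.

Lemma refl_bij (m : int) : bijective (fun i : int => m - i).
Proof. by exists (fun i => m - i) => i; lia. Qed.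

Lemma fsum_shift (V : zmodType) (f : int -> V) m : fsum (fun i => f (i + m)) = fsum f.
Proof. by rewrite -(fsum_reindex f (shift_bij m)). Qed.

Lemma fsum_exchange (V : zmodType) (F : int -> int -> V) N M :
  (forall i j, (N < absz i)%N || (M < absz j)%N -> F i j = 0) ->
  fsum (fun i => fsum (F i)) = fsum (fun j => fsum (F ^~ j)).
Proof.
move=> F0.
transitivity (\sum_(i <- window N) \sum_(j <- window M) F i j).
  rewrite (fsum_window (N := N)) => [|i iN]; last first.
    by apply: fsbig1 => j _; apply: F0; rewrite iN.
  by apply: eq_bigr => i _; apply: fsum_window => j jM; apply: F0; rewrite jM orbT.
rewrite exchange_big /= (fsum_window (N := M)) => [|j jM].
  apply: eq_bigr => j _; apply/esym/fsum_window => i iN.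
  by apply: F0; rewrite iN.
by apply: fsbig1 => i _; apply: F0; rewrite jM orbT.
Qed.

Lemma fsum_even_odd (V : zmodType) (f : int -> V) : fsupp f ->
  fsum f = fsum (fun i => f (2 * i)) + fsum (fun i => f (2 * i + 1)).
Proof.
move=> fs.
pose ev i := if (2 %| i)%Z then f i else 0.
pose od i := if (2 %| i)%Z then 0 else f i.
have -> : fsum f = fsum ev + fsum od.
  rewrite -fsumD; last 2 first.
  - by apply: (fsupp_map (g := fun i x => if (2 %| i)%Z then x else 0)) => // i; case: ifP.
  - by apply: (fsupp_map (g := fun i x => if (2 %| i)%Z then 0 else x)) => // i; case: ifP.
  by apply: eq_fsbigr => i _; rewrite /ev /od; case: ifP; rewrite ?addr0 ?add0r.
congr (_ + _).
  transitivity (\sum_(i \in range (fun i : int => 2 * i)) ev i).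
    apply/esym/fsbig_widen => // i /= [_ ni]; rewrite /ev ifF//.
    by apply/negP => /dvdzP[k ik]; apply: ni; exists k => //; lia.
  rewrite fsbig_image; last by move=> i j _ _; lia.
  by apply: eq_fsbigr => i _; rewrite /ev dvdz_mulr.
transitivity (\sum_(i \in range (fun i : int => 2 * i + 1)) od i).
  apply/esym/fsbig_widen => // i /= [_ ni]; rewrite /od.
  case: ifPn => // nd; exfalso; apply: ni; exists ((i %/ 2)%Z) => //; lia.
rewrite fsbig_image; last by move=> i j _ _; lia.
by apply: eq_fsbigr => i _; rewrite /od ifF//; lia.
Qed.

(** The partial sums of b vanish to the left of its support, and to its right
because the total sum is zero.  In terms of symbols: a Laurent polynomial that
vanishes at 1 is divisible by z^-1 - 1. *)
Lemma fsum_antidiff (R : zmodType) (b : int -> R) : fsupp b -> fsum b = 0 ->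
  exists2 a, fsupp a & forall k, a (k + 1) - a k = b k.
Proof.
move=> [N bN] b0.
pose a (k : int) := \sum_(j <- window N | j < k) b j.
exists a => [|k].
  exists N.+1 => k kN; rewrite /a.
  have [k0|k0] := ltP k 0.
    by rewrite big_seq_cond big1// => j /andP[]; rewrite mem_window; lia.
  rewrite -[RHS]b0 (fsum_window bN) big_seq_cond [RHS]big_seq; apply: eq_bigl => j.
  by rewrite mem_window; case: leqP => //= jN; lia.
rewrite /a; have [kN|kN] := leqP (absz k) N; last first.
  rewrite bN//; apply/eqP; rewrite subr_eq0; apply/eqP.
  rewrite big_seq_cond [RHS]big_seq_cond; apply: eq_bigl => j.
  by rewrite mem_window; case: leqP => //= jN; lia.
have kw : k \in window N by rewrite mem_window.
transitivity (\sum_(j <- window N) ((if (j < k + 1)%R then b j else 0) -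
    (if (j < k)%R then b j else 0))).
  by rewrite sumrB -!big_mkcond.
rewrite (bigD1_seq k) ?uniq_window//= ltxx ltzD1 lexx subr0 big1 ?addr0// => j jk.
by rewrite ltzD1 le_eqVlt (negPf jk) subrr.
Qed.

(** * Subdivision operators, difference stencils and powers *)

Section Subdivision.
Variable R : realType.
Implicit Types (A B X : mseq R) (c d : vseq R).

Lemma mul_mxE (M N : 'M[R]_2) i j : (M *m N) i j = M i 0 * N 0 j + M i 1 * N 1 j.
Proof. by rewrite mxE big_ord_recl big_ord1; congr (_ + M i _ * N _ j); apply: val_inj. Qed.

Lemma mul_mxvE (M : 'M[R]_2) (x : 'cV[R]_2) i :
  (M *m x) i 0 = M i 0 * x 0 0 + M i 1 * x 1 0.
Proof. by rewrite mxE big_ord_recl big_ord1; congr (_ + M i _ * x _ 0); apply: val_inj. Qed.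

Lemma fsupp_subdiv A c i : fsupp A -> fsupp (fun j => A (i - 2 * j) *m c j).
Proof.
apply: (fsupp_comp (h := fun j => i - 2 * j) (g := fun j x => x *m c j) (K := absz i)).
  by move=> j; lia.
by move=> j; rewrite mul0mx.
Qed.

Lemma subdivZ A c (x : R) : fsupp A ->
  subdiv A (fun i => x *: c i) = fun i => x *: subdiv A c i.
Proof.
move=> fA; apply/funext => i; rewrite /subdiv -(fsum_morph (phi := GRing.scale x)).
- by apply: eq_fsbigr => j _; rewrite scalemxAr.
- exact: scalerDr.
- exact: fsupp_subdiv.
Qed.

(** Splitting the index by parity makes the number of terms independent of it. *)
Lemma subdiv_window A c N (m r : int) : supp N A -> 0 <= r <= 1 ->
  subdiv A c (2 * m + r) = \sum_(k <- window N) A (2 * k + r) *m c (m - k).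
Proof.
move=> AN r01; rewrite /subdiv (fsum_reindex _ (refl_bij m)).
rewrite (fsum_window (N := N)) => [|k kN].
  by apply: eq_bigr => k _; congr (A _ *m _); lia.
by rewrite AN ?mul0mx//; lia.
Qed.

Lemma subsum_window (V : zmodType) (f : int -> V) N (r : int) : supp N f -> 0 <= r <= 1 ->
  fsum (fun i => f (2 * i + r)) = \sum_(k <- window N) f (2 * k + r).
Proof. by move=> fN r01; apply: fsum_window => k kN; rewrite fN//; lia. Qed.

Lemma subdiv_cst A (x : 'cV[R]_2) (m r : int) : fsupp A -> 0 <= r <= 1 ->
  subdiv A (fun=> x) (2 * m + r) = fsum (fun i => A (2 * i + r)) *m x.
Proof.
by move=> [N AN] r01; rewrite (subdiv_window _ _ AN r01) (subsum_window AN r01) mulmx_suml.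
Qed.

(** The operators with symbol G1 z^-1 + G0: the Taylor operator, diag(1, Delta) and
the constant matrices are all of this form. *)
Definition stencil (G1 G0 : 'M[R]_2) c : vseq R := fun i => G1 *m c (i + 1) + G0 *m c i.

(** The hypothesis is the identity G(z) X(z) = a B(z) G(z^2) between symbols, read
coefficient by coefficient. *)
Lemma stencil_subdiv (G1 G0 : 'M[R]_2) (a : R) X B : fsupp X -> fsupp B ->
  (forall k, G1 *m X (k + 1) + G0 *m X k = a *: (B (k + 2) *m G1 + B k *m G0)) ->
  forall c, stencil G1 G0 (subdiv X c) = fun i => a *: subdiv B (stencil G1 G0 c) i.
Proof.
move=> fX fB XB c; apply/funext => i; rewrite /stencil /subdiv.
have fB1 d (G : 'M[R]_2) : fsupp (fun j => B (i - 2 * j) *m (G *m d j)).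
  exact: (fsupp_subdiv (fun j => G *m d j)).
transitivity (fsum (fun j => a *: (B (i - 2 * (j - 1)) *m (G1 *m c j)
                                 + B (i - 2 * j) *m (G0 *m c j)))).
  rewrite -!(fsum_morph (phi := mulmx _)); first last.
  - exact: fsupp_subdiv.
  - exact: mulmxDr.
  - exact: fsupp_subdiv.
  - exact: mulmxDr.
  rewrite -fsumD; first last.
  - apply: (fsupp_map (g := fun _ x => G0 *m x)); last exact: fsupp_subdiv.
    by move=> _; rewrite mulmx0.
  - apply: (fsupp_map (g := fun _ x => G1 *m x)); last exact: fsupp_subdiv.
    by move=> _; rewrite mulmx0.
  apply: eq_fsbigr => j _; rewrite !mulmxA -!mulmxDl scalemxAl.
  have -> : i - 2 * (j - 1) = i - 2 * j + 2 by lia.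
  by rewrite -XB; congr ((_ *m X _ + _) *m _); lia.
have fB2 : fsupp (fun j => B (i - 2 * (j - 1)) *m (G1 *m c j)).
  by have := fsupp_shift (-1) (fB1 (fun j => c (j + 1)) G1); under eq_fun do rewrite subrK.
rewrite (fsum_morph (phi := GRing.scale a)); [|exact: scalerDr|exact: fsuppD].
congr (_ *: _); under [RHS]eq_fsbigr do rewrite mulmxDr.
rewrite fsumD// [RHS]fsumD//.
congr (_ + _).
rewrite -(fsum_shift (fun j => B (i - 2 * j) *m (G1 *m c (j + 1))) (-1)).
by apply: eq_fsbigr => j _; rewrite subrK.
Qed.

Lemma stencil_iter (G1 G0 : 'M[R]_2) (a : R) X B : fsupp B ->
  (forall c, stencil G1 G0 (subdiv X c) = fun i => a *: subdiv B (stencil G1 G0 c) i) ->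
  forall n c, stencil G1 G0 (iter n (subdiv X) c)
    = fun i => a ^+ n *: iter n (subdiv B) (stencil G1 G0 c) i.
Proof.
move=> fB XB; elim=> [|n IH] c; first by apply/funext => i; rewrite scale1r.
by rewrite iterS XB IH subdivZ//; apply/funext => i; rewrite scalerA exprS.
Qed.

(** The mask of the n-th power of the subdivision operator, which has dilation
factor 2^n; its columns are the iterates of delta sequences. *)
Fixpoint power_mask A (n : nat) : mseq R :=
  if n is n'.+1 then fun i => fsum (fun k => A (i - 2 * k) *m power_mask A n' k)
  else fun i => if i == 0 then 1%:M else 0.

Lemma supp_power_mask A N n : supp N A -> supp ((2 ^ n).-1 * N) (power_mask A n).
Proof.
move=> AN; elim: n => [|n IH] i /=; first by case: eqP => // ->.
move=> iN; apply: fsbig1 => k _.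
have [kN|kN] := ltnP ((2 ^ n).-1 * N) (absz k); first by rewrite IH ?mulmx0.
rewrite AN ?mul0mx//; have n0 : (0 < 2 ^ n)%N by rewrite expn_gt0.
have : ((2 ^ n.+1).-1 * N = 2 * ((2 ^ n).-1 * N) + N)%N by rewrite expnS; nia.
lia.
Qed.

Lemma fsupp_power_mask A n : fsupp A -> fsupp (power_mask A n).
Proof. by move=> [N AN]; eexists; apply: supp_power_mask AN. Qed.

Lemma fsupp_power_subdiv A n c i : fsupp A ->
  fsupp (fun j => power_mask A n (i - 2 ^+ n * j) *m c j).
Proof.
move=> fA.
have n0 : (0 : int) < 2 ^+ n by rewrite exprn_gt0.
apply: (fsupp_comp (h := fun j => i - 2 ^+ n * j) (g := fun j x => x *m c j) (K := absz i)).
- by move=> j; nia.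
- by move=> j; rewrite mul0mx.
- exact: fsupp_power_mask.
Qed.

Lemma fsupp_power_step A n i : fsupp A ->
  fsupp (fun k => A (i - 2 * k) *m power_mask A n k).
Proof.
apply: (fsupp_comp (h := fun j => i - 2 * j) (g := fun j x => x *m _) (K := absz i)).
- by move=> j; lia.
- by move=> j; rewrite mul0mx.
Qed.

Lemma iter_subdivE A n c i : fsupp A ->
  iter n (subdiv A) c i = fsum (fun j => power_mask A n (i - 2 ^+ n * j) *m c j).
Proof.
move=> fA; elim: n i => [|n IH] i.
  rewrite expr0 (fsum_single (i0 := i)) => [|j ji] /=.
    by rewrite mul1r subrr eqxx mul1mx.
  by rewrite mul1r subr_eq0 eq_sym (negPf ji) mul0mx.
have [N AN] := fA; have pN := supp_power_mask (n := n) AN.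
have n0 : (0 : int) < 2 ^+ n by rewrite exprn_gt0.
transitivity (fsum (fun j => fsum (fun k =>
    A (i - 2 * j) *m (power_mask A n (j - 2 ^+ n * k) *m c k)))).
  rewrite iterS; apply: eq_fsbigr => j _; rewrite IH -(fsum_morph (phi := mulmx _))//.
    exact: mulmxDr.
  exact: fsupp_power_subdiv.
rewrite (fsum_exchange (N := absz i + N) (M := absz i + N + (2 ^ n).-1 * N)); last first.
  move=> j k jk; have [jN|jN] := ltnP N (absz (i - 2 * j)%R); first by rewrite AN ?mul0mx.
  by rewrite pN ?mul0mx ?mulmx0//; nia.
apply: eq_fsbigr => k _ /=.
rewrite -(fsum_morph (phi := fun M => M *m c k)); first last.
- exact: fsupp_power_step.
- by move=> x y; rewrite mulmxDl.
rewrite -(fsum_shift _ (- (2 ^+ n * k))); apply: eq_fsbigr => j _.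
rewrite mulmxA exprS; congr (A _ *m _ *m _); lia.
Qed.

(** The symbol of the power mask, evaluated at 1. *)
Lemma fsum_power_mask A n : fsupp A ->
  fsum (power_mask A n.+1) = fsum A *m fsum (power_mask A n).
Proof.
move=> fA; have [N AN] := fA; have pN := supp_power_mask (n := n) AN.
move: ((2 ^ n).-1 * N)%N pN => M pN.
rewrite /= (fsum_exchange (N := N + 2 * M) (M := M)); last first.
  move=> j k jk; have [kN|kN] := ltnP M (absz k); first by rewrite pN ?mulmx0.
  by rewrite AN ?mul0mx//; lia.
rewrite -(fsum_morph (phi := mulmx _)); [|exact: mulmxDr|exact: fsupp_power_mask].
apply: eq_fsbigr => k _.
rewrite -(fsum_shift A (- (2 * k))) -(fsum_morph (phi := fun M => M *m _))//.
  by move=> x y; rewrite mulmxDl.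
exact: fsupp_shift.
Qed.

End Subdivision.

(** * Norms and uniform convergence *)

Section Norms.
Variable R : realType.

Lemma norm_vecP (x : 'cV[R]_2) e : 0 <= e ->
  (`|x| <= e) = (`|x 0 0| <= e) && (`|x 1 0| <= e).
Proof.
move=> e0; rewrite /Num.Def.normr/= mx_normrE.
apply/idP/andP => [xe|[x0 x1]].
  by split; apply: le_trans xe;
    [apply: (le_bigmax _ (fun ij : 'I_2 * 'I_1 => `|x ij.1 ij.2|) (0, 0))
    |apply: (le_bigmax _ (fun ij : 'I_2 * 'I_1 => `|x ij.1 ij.2|) (1, 0))].
apply: bigmax_le => // -[i j] _ /=; rewrite (ord1 j).
by case: (unliftP 0 i) => [k ->|->//]; rewrite (ord1 k) (_ : lift _ _ = 1)//; apply: val_inj.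
Qed.

Lemma norm_entry (x : 'cV[R]_2) i : `|x i 0| <= `|x|.
Proof.
have := lexx `|x|; rewrite {1}norm_vecP// => /andP[x0 x1].
by case: (unliftP 0 i) => [k ->|->//]; rewrite (ord1 k) (_ : lift _ _ = 1)//; apply: val_inj.
Qed.

Definition mx_bound (M : 'M[R]_2) : R := `|M 0 0| + `|M 0 1| + `|M 1 0| + `|M 1 1|.

Lemma mx_bound_ge0 M : 0 <= mx_bound M.
Proof. by rewrite /mx_bound !addr_ge0. Qed.

Lemma norm_mulmx (M : 'M[R]_2) (x : 'cV[R]_2) : `|M *m x| <= mx_bound M * `|x|.
Proof.
have b i : `|(M *m x) i 0| <= (`|M i 0| + `|M i 1|) * `|x|.
  rewrite mul_mxvE (le_trans (ler_normD _ _))// !normrM mulrDl.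
  by rewrite lerD// ler_wpM2l// norm_entry.
rewrite norm_vecP ?mulr_ge0 ?mx_bound_ge0//; apply/andP; split.
all: apply: le_trans (b _) _; rewrite ler_wpM2r// /mx_bound.
- by rewrite -addrA lerDl addr_ge0.
- by rewrite -addrA [X in _ <= X]addrC lerDl addr_ge0.
Qed.

Lemma bounded_vseqP (c : vseq R) : bounded_fun c <-> exists K, forall i, `|c i| <= K.
Proof.
split=> [[M [Mr cM]]|[K cK]].
  by exists (M + 1) => i; apply: (cM (M + 1)) => //; rewrite ltrDl.
exists K; split; first exact: num_real.
by move=> M KM i _; apply: le_trans (cK i) (ltW KM).
Qed.

Lemma converges_toP (c : nat -> vseq R) (Psi : R -> 'cV[R]_2) :
  converges_to c Psi <->
  forall e, 0 < e -> \forall n \near \oo, forall i : int, `|c n i - Psi (i%:~R / 2 ^+ n)| <= e.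
Proof.
rewrite /converges_to; set s := fun n : nat => ereal_sup _.
have s0 n : (0 <= s n)%E.
  by apply: le_trans (ereal_sup_ubound _); last (by exists 0); rewrite lee_fin.
have sE n e : 0 <= e ->
    (s n <= e%:E)%E <-> forall i : int, `|c n i - Psi (i%:~R / 2 ^+ n)| <= e.
  move=> e0; split=> [se i|ce]; last by apply: ge_ereal_sup => _ [i _ <-]; rewrite lee_fin.
  by rewrite -lee_fin; apply: le_trans se; apply: ereal_sup_ubound; exists i.
split=> [/fine_cvgP[sfin scvg] e e0|ce].
  move/cvgrPdist_le : scvg => /(_ _ e0) scvg.
  apply: filterS2 sfin scvg => n sn; rewrite /= sub0r normrN => le_e.
  apply/sE; first exact: ltW.
  by rewrite -(fineK sn) lee_fin (le_trans _ le_e)// ler_norm.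
apply/fine_cvgP; split.
  apply: filterS (ce _ ltr01) => n /sE -/(_ ler01) s1.
  by rewrite ge0_fin_numE// (le_lt_trans s1)// ltry.
apply/cvgrPdist_le => e e0; apply: filterS (ce _ e0) => n /sE -/(_ (ltW e0)) s1.
rewrite /= sub0r normrN ger0_norm ?fine_ge0// -lee_fin fineK//.
by rewrite ge0_fin_numE// (le_lt_trans s1)// ltry.
Qed.

Lemma pow2_small (K e : R) : 0 < e -> \forall n \near \oo, K / 2 ^+ n <= e.
Proof.
move=> e0; have := @cvg_geometric R K 2^-1; rewrite ger0_norm// invf_lt1// ltr1n => /(_ isT).
move=> /cvgrPdist_le /(_ _ e0); apply: filterS => n; rewrite /geometric /= sub0r normrN exprVn.
by apply: le_trans; rewrite ler_norm.
Qed.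

Lemma subdiv_bounded (A : mseq R) : fsupp A -> exists2 K, 0 <= K &
  forall c M, (forall i, `|c i| <= M) -> forall i, `|subdiv A c i| <= K * M.
Proof.
move=> [N AN]; exists (\sum_(k <- window N) (mx_bound (A (2 * k)) + mx_bound (A (2 * k + 1)))).
  by rewrite sumr_ge0// => k _; rewrite addr_ge0// mx_bound_ge0.
move=> c M cM i.
have M0 : 0 <= M by apply: le_trans (cM 0).
have [m [r [r01 ->]]] : exists m r : int, (r = 0 \/ r = 1) /\ i = 2 * m + r.
  by exists (i %/ 2)%Z, (i %% 2)%Z; lia.
rewrite (subdiv_window _ _ AN); last by lia.
rewrite (le_trans (ler_norm_sum _ _ _))// mulr_suml ler_sum// => k _.
apply: le_trans (norm_mulmx _ _) _; apply: ler_pM; rewrite ?mx_bound_ge0//.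
by case: r01 => ->; rewrite ?addr0 ?lerDl ?lerDr mx_bound_ge0.
Qed.

(** Finitely many exceptional levels, each bounded, do not destroy a uniform
bound. *)
Lemma uniform_bound (f : nat -> int -> 'cV[R]_2) (K : R) n0 :
  (forall n, (n0 <= n)%N -> forall i, `|f n i| <= K) ->
  (forall n, exists K', forall i, `|f n i| <= K') ->
  exists K', forall n i, `|f n i| <= K'.
Proof.
move=> fK fn; elim: n0 K fK => [|m IH] K fK; first by exists K => n; apply: fK.
have [K' fm] := fn m; apply: (IH (Num.max K K')) => n.
rewrite leq_eqVlt => /orP[/eqP <- i|mn i]; rewrite le_max ?fm ?orbT//.
by rewrite fK.
Qed.

Lemma iter_subdiv_bounded (A : mseq R) c n : fsupp A -> (exists K, forall i, `|c i| <= K) ->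
  exists K, forall i, `|iter n (subdiv A) c i| <= K.
Proof.
move=> fA cK; elim: n => // n [K cnK]; have [L _ AL] := subdiv_bounded fA.
by exists (L * K) => i; apply: AL.
Qed.

End Norms.

(** * Convergent vector schemes *)

Section Vector_schemes.
Variables (R : realType) (A : mseq R).
Hypothesis fA : fsupp A.

Definition delta (x : 'cV[R]_2) : vseq R := fun i => if i == 0 then x else 0.

Lemma iter_delta n x i : iter n (subdiv A) (delta x) i = power_mask A n i *m x.
Proof.
rewrite iter_subdivE//.
rewrite (fsum_single (i0 := 0)) => [|j j0]; first by rewrite mulr0 subr0 /delta eqxx.
by rewrite /delta (negPf j0) mulmx0.
Qed.

Lemma bounded_delta x : exists K, forall i, `|delta x i| <= K.
Proof. by exists `|x| => i; rewrite /delta; case: eqP => // _; rewrite normr0. Qed.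

Lemma continuous_bounded_itv (Psi : R -> 'cV[R]_2) (a : R) : continuous Psi -> 0 <= a ->
  exists K, forall x, `|x| <= a -> `|Psi x| <= K.
Proof.
move=> cPsi a0.
have cn : continuous (fun x => `|Psi x|).
  by move=> x; apply: (continuous_comp (cPsi x)); apply: norm_continuous.
have aa : - a <= a by rewrite (le_trans _ a0)// oppr_le0.
have [c _ cM] := EVT_max aa (continuous_subspaceT cn).
by exists `|Psi c| => x; rewrite ler_norml => xa; apply: cM; rewrite in_itv.
Qed.

Hypothesis cvgA : forall c, bounded_fun c -> exists Psi, vector_limit A c Psi.

(** After rescaling by 2^-n all iterates of a delta sequence live on [-N, N], and
there their continuous limit is bounded. *)
Lemma power_mask_bounded (x : 'cV[R]_2) : exists2 K, 0 <= K & forall n i, `|power_mask A n i *m x| <= K.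
Proof.
have /bounded_vseqP bd := bounded_delta x.
have [Psi [cPsi /converges_toP cnv]] := cvgA bd.
have [n0 _ n0P] := cnv _ ltr01.
have [N AN] := fA.
have [L LP] := continuous_bounded_itv cPsi (ler0n R N).
have L0 : 0 <= L by apply: le_trans (LP 0 _); rewrite ?normr0.
(* Outside the support the iterate vanishes; inside it is within 1 of the limit. *)
have [||K KP] := @uniform_bound _ (fun (n : nat) (i : int) => power_mask A n i *m x) (1 + L) n0.
- move=> n n0n i; have [iN|iN] := leqP (absz i) (2 ^ n * N); last first.
    rewrite (supp_power_mask AN) ?mul0mx ?normr0 ?addr_ge0//.
    by apply: leq_ltn_trans iN; rewrite leq_mul2r leq_pred orbT.
  rewrite -iter_delta -[X in `|X|](subrK (Psi (i%:~R / 2 ^+ n))).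
  rewrite (le_trans (ler_normD _ _))// lerD ?n0P//.
  apply: LP; rewrite normrM normfV (ger0_norm (exprn_ge0 _ _))// ler_pdivrMr ?exprn_gt0//.
  by rewrite -intr_norm -abszE mulrC -natrX -natrM; rewrite pmulrn ler_nat.
- move=> n; have [K KP] := iter_subdiv_bounded n fA (bounded_delta x).
  by exists K => i; rewrite -iter_delta.
by exists K => //; apply: le_trans (KP 0%N 0).
Qed.

(** By superposition: each value of an iterate is a combination of boundedly many
initial values, whose coefficients are bounded by [power_mask_bounded]. *)
Lemma scheme_bounded : exists2 K, 0 <= K &
  forall c M, (forall i, `|c i| <= M) -> forall n i, `|iter n (subdiv A) c i| <= K * M.
Proof.
have [K0 K00 KP0] := power_mask_bounded (vec2 1 0).
have [K1 K10 KP1] := power_mask_bounded (vec2 0 1).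
have [N AN] := fA.
exists (\sum_(k <- window N.+1) (K0 + K1)) => [|c M cM n i].
  by rewrite sumr_ge0// => k _; rewrite addr_ge0.
have M0 : 0 <= M by apply: le_trans (cM 0).
pose q := (i %/ 2 ^+ n)%Z; pose r := (i %% 2 ^+ n)%Z.
have n0 : (0 : int) < 2 ^+ n by rewrite exprn_gt0.
have iE : i = q * 2 ^+ n + r by exact: divz_eq.
have r0 : 0 <= r by rewrite modz_ge0// gt_eqF.
have rn : r < 2 ^+ n by rewrite ltz_pmod.
(* With i = 2^n q + r and 0 <= r < 2^n, the bound |r + 2^n k| <= 2^n N forces
   |k| <= N + 1. *)
rewrite iter_subdivE// (fsum_reindex _ (refl_bij q)) (fsum_window (N := N.+1)); last first.
  move=> k kN; rewrite (supp_power_mask AN) ?mul0mx//.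
  have -> : i - 2 ^+ n * (q - k) = r + 2 ^+ n * k by rewrite {1}iE; ring.
  have : (2 ^ n)%:Z = 2 ^+ n :> int by rewrite -[LHS]natz natrX.
  move: rn n0; move: (2 ^+ n) => t rn n0 tn.
  suff : N%:Z * t < `|r + t * k|%R.
    by move=> ?; apply: (@leq_ltn_trans (2 ^ n * N)); [rewrite leq_mul2r leq_pred orbT|lia].
  have [k0|k0] := leP 0 k; first by rewrite ger0_norm; nia.
  by rewrite ltr0_norm; nia.
rewrite (le_trans (ler_norm_sum _ _ _))// mulr_suml ler_sum// => k _.
have cE : c (q - k) = c (q - k) 0 0 *: vec2 1 0 + c (q - k) 1 0 *: vec2 0 1.
  apply/colP => j; rewrite !mxE; case: (unliftP 0 j) => [j' ->|->] /=.
    by rewrite (ord1 j') (_ : lift _ _ = 1) ?mulr0 ?mulr1 ?add0r//; apply: val_inj.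
  by rewrite mulr0 mulr1 addr0.
rewrite cE mulmxDr -!scalemxAr (le_trans (ler_normD _ _))// !normrZ [leRHS]mulrC [leRHS]mulrDr.
by rewrite lerD// ler_pM// (le_trans (norm_entry _ _)).
Qed.


(** Near x one subdivision step computes values close to Psi x from values close to
Psi x, the coefficients adding up to the even or the odd sum of the mask. *)
Lemma vector_limit_fixed c (Psi : R -> 'cV[R]_2) (r : int) x : vector_limit A c Psi ->
  0 <= r <= 1 -> fsum (fun i => A (2 * i + r)) *m Psi x = Psi x.
Proof.
move=> [cPsi /converges_toP cnv] r01.
have [N AN] := fA.
pose K := \sum_(k <- window N) mx_bound (A (2 * k + r)).
have K0 : 0 <= K by rewrite sumr_ge0// => k _; rewrite mx_bound_ge0.
apply/eqP; rewrite -subr_eq0 -normr_le0; apply/ler_addgt0Pr => e e0; rewrite add0r.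
pose d := e / (K + 1) / 2.
have d0 : 0 < d by rewrite !divr_gt0// ltr_wpDl.
have /cvgrPdist_le /(_ _ d0) /nbhs_ballP [h /= h0 hP] := cPsi x.
have [n1 _ n1P] := cnv _ d0.
have h2 : 0 < h / 2 by rewrite divr_gt0.
have [n2 _ n2P] := pow2_small N.+2%:R h2.
pose n := maxn n1 n2.
(* The margin N + 2 covers a shift by at most N, the rounding in the floor and
   the parity r. *)
have close (m : nat) (k : int) : (n <= m)%N -> `|k%:~R - x * 2 ^+ m| <= N.+2%:R ->
    `|iter m (subdiv A) c k - Psi x| <= d + d.
  rewrite geq_max => /andP[nm1 nm2] kx.
  rewrite -(subrKA (Psi (k%:~R / 2 ^+ m))) (le_trans (ler_normD _ _))// lerD//; first exact: n1P.
  rewrite distrC; apply: hP; rewrite /ball /= distrC.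
  have m0 : 0 < 2 ^+ m :> R by rewrite exprn_gt0.
  have -> : k%:~R / 2 ^+ m - x = (k%:~R - x * 2 ^+ m) / 2 ^+ m by rewrite mulrBl mulfK// gt_eqF.
  rewrite normrM normfV (gtr0_norm m0) (@le_lt_trans _ _ (h / 2))//; last by lra.
  by apply: le_trans (n2P m nm2); rewrite ler_wpM2r// invr_ge0 ltW.
pose i := Num.floor (x * 2 ^+ n).
have ix : i%:~R <= x * 2 ^+ n < i%:~R + 1 by rewrite -[i%:~R + 1]intrD1 floor_itv.
have E1 : `|iter n.+1 (subdiv A) c (2 * i + r) - Psi x| <= d + d.
  apply: close; first exact: leqnSn.
  have r01' : 0 <= (r%:~R : R) <= 1 by rewrite ler0z lerz1.
  have N2 : 2 <= N.+2%:R :> R by rewrite ler_nat.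
  rewrite exprS intrD intrM ler_norml; lra.
have E2 k : k \in window N -> `|iter n (subdiv A) c (i - k) - Psi x| <= d + d.
  rewrite mem_window => kN; apply: close => //.
  have kN' : `|k%:~R| <= N%:R :> R by rewrite -intr_norm -abszE ler_nat.
  move: kN'; rewrite !ler_norml intrB -[N.+2]addn2 natrD; lra.
rewrite iterS (subdiv_window _ _ AN r01) in E1.
rewrite (subsum_window AN r01) mulmx_suml.
rewrite -(subrKA (\sum_(k <- window N) A (2 * k + r) *m iter n (subdiv A) c (i - k))).
rewrite (le_trans (ler_normD _ _))//.
have -> : e = K * (d + d) + (d + d).
  by rewrite /d; field; rewrite gt_eqF// ltr_wpDl.
rewrite lerD// -sumrB (le_trans (ler_norm_sum _ _ _))// mulr_suml.
rewrite big_seq [leRHS]big_seq ler_sum// => k kN.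
by rewrite -mulmxBr (le_trans (norm_mulmx _ _))// ler_wpM2l ?mx_bound_ge0// distrC E2.
Qed.

Hypothesis vanish : forall c Psi, bounded_fun c -> vector_limit A c Psi ->
  forall x, Psi x 0 0 = 0.

(** The sum of S^n delta has upper left entry a^n, where a is that of the sum of
the mask.  The first components of S^n delta tend uniformly to zero and at most
a constant times 2^n of them do not vanish, so that a^n = o(2^n). *)
Lemma contractive_corner : (fsum A) 0 1 = 0 -> `|(fsum A) 0 0| < 2.
Proof.
move=> A01.
have pE n : (fsum (power_mask A n)) 0 0 = (fsum A) 0 0 ^+ n.
  elim: n => [|n IH]; last by rewrite fsum_power_mask// mul_mxE IH A01 mul0r addr0 exprS.
  transitivity ((1%:M : 'M[R]_2) 0 0); last by rewrite mxE.
  by rewrite /= (fsum_single (i0 := 0)) => [|i i0]; rewrite ?eqxx ?(negPf i0).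
have [N AN] := fA.
(* The support of the n-th iterate has at most 2^(n+1) N + 1 elements, and e is
   small enough for that many terms of size e to add up to less than 2^n. *)
pose e : R := (N.*2.+2)%:R^-1 / 2.
have e0 : 0 < e by rewrite divr_gt0// invr_gt0.
have /bounded_vseqP bd := bounded_delta (vec2 1 0).
have [Psi limPsi] := cvgA bd; have Psi0 := vanish bd limPsi.
have [_ /converges_toP /(_ _ e0)[n _ /(_ n (leqnn n)) nP]] := limPsi.
rewrite ltNge; apply/negP => A2.
have : 2 ^+ n <= `|(fsum (power_mask A n)) 0 0|.
  by rewrite pE normrX lerXn2r// nnegrE.
apply/negP; rewrite -ltNge.
have pN := supp_power_mask (n := n) AN.
have {}pN : supp (2 ^ n * N) (power_mask A n).
  by apply: supp_le pN; rewrite leq_mul2r leq_pred orbT.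
rewrite (fsum_window pN) summxE (le_lt_trans (ler_norm_sum _ _ _))//.
apply: (@le_lt_trans _ _ (\sum_(i <- window (2 ^ n * N)) e)).
  apply: ler_sum => i _; apply: le_trans (nP i); rewrite iter_delta.
  apply: le_trans (norm_entry _ 0); rewrite !mxE/=.
  by rewrite Psi0 subr0 big_ord_recl big_ord1 !mxE/= mulr1 mulr0 addr0.
rewrite big_const_seq count_predT iter_addr_0 size_map size_iota.
have t1 : 1 <= 2 ^+ n :> R by rewrite exprn_ege1// ler1n.
have N0 := ler0n R N; have tN : 0 <= 2 ^+ n * N%:R :> R by rewrite mulr_ge0// ltW.
rewrite -[e *+ _]mulr_natr /e -mulrA mulrC ltr_pdivrMr ?ltr0n//.
have -> : (2 ^ n * N).*2.+1%:R = 2 * (2 ^+ n * N%:R) + 1 :> R.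
  by rewrite -addn1 natrD -mul2n !natrM natrX.
have -> : N.*2.+2%:R = 2 * N%:R + 2 :> R by rewrite -addn2 natrD -mul2n natrM.
rewrite mulrDr mulrCA; lra.
Qed.

End Vector_schemes.

(** * Integrating uniformly convergent difference quotients *)

Section Integration.
Variable R : realType.

(** The sequences u n - 2 K / 2^n and u n + 2 K / 2^n are monotone and squeeze the
limit. *)
Lemma geometric_limit (u : nat -> R) (K : R) :
  (forall n, `|u n.+1 - u n| <= K / 2 ^+ n) -> exists l, forall n, `|u n - l| <= 2 * K / 2 ^+ n.
Proof.
move=> uK; pose r n := 2 * K / 2 ^+ n.
have K0 : 0 <= K by have := le_trans (normr_ge0 _) (uK 0%N); rewrite expr0 divr1.
have rS n : r n.+1 = K / 2 ^+ n.
  by rewrite /r exprS; field; rewrite expf_neq0.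
have rE n : r n = K / 2 ^+ n + K / 2 ^+ n by rewrite /r -mulrA; ring.
have r0 n : 0 <= r n by rewrite /r divr_ge0 ?mulr_ge0// exprn_ge0.
have vS n : u n - r n <= u n.+1 - r n.+1 /\ u n.+1 + r n.+1 <= u n + r n.
  by have := uK n; rewrite rS rE ler_norml; lra.
have vw n k : u n - r n <= u (n + k)%N - r (n + k)%N /\ u (n + k)%N + r (n + k)%N <= u n + r n.
  elim: k => [|k [IH1 IH2]]; first by rewrite addn0.
  by rewrite addnS; have [? ?] := vS (n + k)%N; split; lra.
have vlew n m : u n - r n <= u m + r m.
  have [/subnKC E|/ltnW/subnKC E] := leqP n m.
    by have [] := vw n (m - n)%N; rewrite E; have := r0 m; lra.
  by have [] := vw m (n - m)%N; rewrite E; have := r0 n; lra.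
pose S := range (fun n => u n - r n).
have Sub m : ubound S (u m + r m) by move=> _ [n _ <-].
have Ssup : has_sup S by split; [exists (u 0%N - r 0%N), 0%N|exists (u 0%N + r 0%N)].
exists (sup S) => n; rewrite ler_norml.
have h1 : u n - r n <= sup S by apply: sup_upper_bound => //; exists n.
have h2 : sup S <= u n + r n by apply: ge_sup => //; case: Ssup.
by rewrite -/(r n); lra.
Qed.

Lemma derive_of_increments (F psi : R -> R) (t : R) :
  (forall e, 0 < e -> exists2 d, 0 < d & forall a b, t - d <= a -> a <= b -> b <= t + d ->
     `|F b - F a - psi t * (b - a)| <= e * (b - a)) ->
  is_derive t (1 : R) (F : R -> R^o) (psi t).
Proof.
move=> incr.
have cv : h^-1 *: (F (h *: 1 + t) - F t : R^o) @[h --> (0 : R)^'] --> (psi t : R^o).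
  apply/cvgrPdist_le => e e0; have [d d0 dP] := incr e e0.
  near=> h.
  have h0 : h != 0 by near: h; exact: nbhs_dnbhs_neq.
  have hd : `|h| <= d by near: h; exact: dnbhs0_le.
  have -> : psi t - h^-1 *: (F (h *: 1 + t) - F t : R^o)
      = - h^-1 * (F (h + t) - F t - psi t * h).
    by rewrite /GRing.scale /= mulr1; field.
  rewrite normrM normrN normfV mulrC ler_pdivrMr ?normr_gt0//.
  move: hd; rewrite ler_norml => hd.
  have [h1|h1] := leP 0 h.
    by have := dP t (h + t); rewrite addrK (ger0_norm h1); apply; lra.
  rewrite (ltr0_norm h1) -normrN.
  have -> : - (F (h + t) - F t - psi t * h) = F t - F (h + t) - psi t * (t - (h + t)) by ring.
  have hE : - h = t - (h + t) by rewrite opprD addrCA subrr addr0.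
  by rewrite hE; apply: dP; [rewrite addrC lerD2r; case/andP: hd|rewrite gerDr ltW|rewrite lerDl ltW].
apply: DeriveDef; first by apply/cvg_ex; exists (psi t).
exact: cvg_lim cv.
Unshelve. all: by end_near. Qed.

(** A Riemann sum estimate: each increment is close to the same number. *)
Lemma telescope_bound (x : int -> R) (a e : R) (p : int) k :
  (forall j, p <= j < p + k%:Z -> `|x (j + 1) - x j - a| <= e) ->
  `|x (p + k%:Z) - x p - a * k%:R| <= e * k%:R.
Proof.
elim: k => [|k IH] xk; first by rewrite addr0 subrr !mulr0 subr0 normr0.
have {}IH : `|x (p + k%:Z) - x p - a * k%:R| <= e * k%:R.
  by apply: IH => j pj; apply: xk; lia.
have pk : p <= p + k%:Z < p + k.+1%:Z by lia.
have xk1 := xk _ pk; have pkE : p + k%:Z + 1 = p + k.+1%:Z by lia.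
rewrite pkE in xk1.
by rewrite -[in k.+1%:R]natr1; move: IH xk1; rewrite !ler_norml; lra.
Qed.

(** The primitive is F t = lim x n (floor (2^n t)).  The last two hypotheses make
this limit exist with error O(2^-n) uniformly in t.  An increment of F is a limit
of sums of differences of x n, that is of Riemann sums of psi, whence the
derivative; no integral is needed. *)
Lemma integration (x : nat -> int -> R) (psi : R -> R) (K : R) :
  continuous psi ->
  (forall e, 0 < e -> \forall n \near \oo, forall i : int,
     `|2 ^+ n * (x n (i + 1) - x n i) - psi (i%:~R / 2 ^+ n)| <= e) ->
  (forall n i, `|x n (i + 1) - x n i| <= K / 2 ^+ n) ->
  (forall n i, `|x n.+1 (2 * i) - x n i| <= K / 2 ^+ n) ->
  exists2 F : R -> R, forall t, is_derive t (1 : R) (F : R -> R^o) (psi t) &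
    forall e, 0 < e -> \forall n \near \oo, forall i : int,
      `|x n i - F (i%:~R / 2 ^+ n)| <= e.
Proof.
move=> cpsi dx x1 x2.
have K0 : 0 <= K by have := le_trans (normr_ge0 _) (x1 0%N 0); rewrite expr0 divr1.
have pw n : 0 < 2 ^+ n :> R by rewrite exprn_gt0.
pose f (n : nat) (t : R) := x n (Num.floor (t * 2 ^+ n)).
have floorP (y : R) : (Num.floor y)%:~R <= y < (Num.floor y)%:~R + 1.
  by rewrite -[_ + 1]intrD1 floor_itv.
have fS t n : `|f n.+1 t - f n t| <= 2 * K / 2 ^+ n.
  rewrite /f; set q := Num.floor (t * 2 ^+ n); set q' := Num.floor _.
  have x2q := x2 n q; have x1q := x1 n.+1 (2 * q).
  have Kn : K / 2 ^+ n.+1 <= K / 2 ^+ n.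
    by rewrite ler_wpM2l// lef_pV2 ?posrE// ler_eXn2l ?ltr1n.
  have Kn0 : 0 <= K / 2 ^+ n by rewrite divr_ge0// ltW.
  (* The dyadic approximation at level n+1 is one of the two children. *)
  have [->|->] : q' = 2 * q \/ q' = 2 * q + 1.
    have := floorP (t * 2 ^+ n); have := floorP (t * 2 ^+ n.+1); rewrite -/q -/q' exprS.
    move=> h1 h2; have : ((2 * q)%:~R : R) < (q' + 1)%:~R by rewrite intrM intrD; lra.
    have : (q'%:~R : R) < (2 * q + 2)%:~R by rewrite intrD intrM; lra.
    by rewrite !ltr_int; lia.
  - by rewrite -mulrA; lra.
  - by move: x1q x2q; rewrite -mulrA !ler_norml; lra.
have /choice[F FP] : forall t, exists l, forall n, `|f n t - l| <= 2 * (2 * K) / 2 ^+ n.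
  by move=> t; apply: geometric_limit (fS t).
exists F; last first.
  move=> e e0; apply: filterS (pow2_small (2 * (2 * K)) e0) => n nK i.
  apply: le_trans nK; apply: le_trans (FP (i%:~R / 2 ^+ n) n).
  by rewrite /f divfK ?gt_eqF// intrKfloor.
move=> t; apply: derive_of_increments => e e0.
have e2 : 0 < e / 2 by rewrite divr_gt0.
have /cvgrPdist_le /(_ _ e2) /nbhs_ballP [h /= h0 hP] := cpsi t.
have h2 : 0 < h / 2 by rewrite divr_gt0.
exists (h / 2) => // a b ta ab bt.
apply/ler_addgt0Pr => s s0.
near \oo => n.
have n1 : 1 / 2 ^+ n <= h / 3.
  by near: n; apply: pow2_small; rewrite divr_gt0.
have n2 : forall i : int, `|2 ^+ n * (x n (i + 1) - x n i) - psi (i%:~R / 2 ^+ n)| <= e / 2.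
  by near: n; apply: dx.
have n3 : (8 * K + `|psi t| + e) / 2 ^+ n <= s by near: n; apply: pow2_small.
pose p := Num.floor (a * 2 ^+ n); pose q := Num.floor (b * 2 ^+ n).
have pq : p <= q by apply: le_floor; rewrite ler_wpM2r// ltW.
pose k := absz (q - p).
have qE : q = p + k%:Z by rewrite /k; lia.
pose w : R := (2 ^+ n)^-1.
have w0 : 0 < w by rewrite invr_gt0.
have pwE : 2 ^+ n * w = 1 by rewrite mulfV ?gt_eqF.
have fl (y : R) : (Num.floor (y * 2 ^+ n))%:~R * w <= y < (Num.floor (y * 2 ^+ n))%:~R * w + w.
  have /andP[f1 f2] := floorP (y * 2 ^+ n).
  by rewrite ler_pdivrMr// f1 /= -[X in _ < _ + X]mul1r -mulrDl ltr_pdivlMr.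
have main : `|x n q - x n p - psi t * w * k%:R| <= e * w * k%:R.
  rewrite qE; apply: telescope_bound => j /andP[pj jq].
  have -> : x n (j + 1) - x n j - psi t * w = (2 ^+ n * (x n (j + 1) - x n j) - psi t) * w.
    by rewrite mulrBl mulrAC pwE mul1r.
  rewrite normrM (gtr0_norm w0) ler_pM2r// -(subrKA (psi (j%:~R / 2 ^+ n))).
  rewrite (splitr e) (le_trans (ler_normD _ _))// lerD// distrC.
  apply: hP; rewrite /ball /= -/w.
  have jq' : (j%:~R : R) <= q%:~R by rewrite ler_int qE ltW.
  have pj' : (p%:~R : R) <= j%:~R by rewrite ler_int.
  have {}jq' := ler_wpM2r (ltW w0) jq'; have {}pj' := ler_wpM2r (ltW w0) pj'.
  have := fl a; have := fl b; rewrite -/p -/q ltr_norml; rewrite div1r -/w in n1; lra.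
have kE : k%:R = q%:~R - p%:~R :> R.
  by rewrite -intrB qE addrAC subrr add0r.
have [Fa Fb] := (FP a n, FP b n); rewrite /f -/p -/q -/w in Fa Fb.
have kw : `|k%:R * w - (b - a)| <= w.
  by rewrite kE mulrBl ler_norml; have := fl a; have := fl b; rewrite -/p -/q; lra.
have pkw : `|psi t * (k%:R * w - (b - a))| <= `|psi t| * w.
  by rewrite normrM ler_wpM2l.
have ekw : e * (k%:R * w) <= e * (b - a + w).
  by rewrite ler_pM2l//; move: kw; rewrite ler_norml; lra.
rewrite -/w in n3.
have -> : F b - F a - psi t * (b - a) = (F b - x n q) + (x n p - F a)
    + (x n q - x n p - psi t * w * k%:R) + psi t * (k%:R * w - (b - a)) by ring.
rewrite distrC in Fb.
rewrite (le_trans (ler_normD _ _))//.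
apply: le_trans (lerD (le_trans (ler_normD _ _) (lerD (ler_normD _ _) (lexx _))) (lexx _)) _.
apply: le_trans (lerD (lerD (lerD Fb Fa) main) pkw) _.
rewrite mulrAC -mulrA in ekw *.
lra.
Unshelve. all: by end_near. Qed.

End Integration.

(** * Symbols and two-by-two matrices *)

Section Algebra.
Variable R : realType.
Implicit Types (a b : int -> R) (A B X V : mseq R).

Lemma symbol_lin a b x y z : fsupp a -> fsupp b ->
  symbol (fun k => x * a k + y * b k) z = x * symbol a z + y * symbol b z.
Proof.
move=> fa fb; have fz (c : int -> R) : fsupp c -> fsupp (fun i => c i * z ^ i).
  by apply: (fsupp_map (g := fun i t => t * z ^ i)) => i; rewrite mul0r.
have fx (c : int -> R) (t : R) : fsupp c -> fsupp (fun i => t * c i).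
  by apply: (fsupp_map (g := fun i s => t * s)) => i; rewrite mulr0.
rewrite /symbol -(fsumZ x (fz _ fa)) -(fsumZ y (fz _ fb)).
rewrite -(fsumD (fx _ x (fz _ fa)) (fx _ y (fz _ fb))).
by apply: eq_fsbigr => k _; rewrite mulrDl !mulrA.
Qed.

Lemma symbol_shift a m z : z != 0 -> fsupp a ->
  symbol (fun k => a (k + m)) z = z ^ (- m) * symbol a z.
Proof.
move=> z0 fa; rewrite /symbol -fsumZ.
  rewrite -[RHS](fsum_shift _ m); apply: eq_fsbigr => k _.
  by rewrite mulrCA -expfzDr// addrCA addNr addr0.
by apply: (fsupp_map (g := fun i t => t * z ^ i)) fa => i; rewrite mul0r.
Qed.

(** Multiplied by z^N the symbol is a polynomial, and it vanishes at all integers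
from 2 on. *)
Lemma symbol_eq0 a : fsupp a -> (forall z, z != 0 -> z != 1 -> symbol a z = 0) ->
  forall k, a k = 0.
Proof.
move=> [N aN] a0.
pose p := \poly_(k < N.*2.+1) a (k%:Z - N%:Z).
have pE z : z != 0 -> p.[z] = z ^+ N * symbol a z.
  move=> z0; rewrite horner_poly /symbol (fsum_window (N := N)) => [|i iN]; last first.
    by rewrite aN ?mul0r.
  rewrite big_map -[X in iota _ X]subn0 -/(index_iota 0 N.*2.+1) big_mkord mulr_sumr.
  apply: eq_bigr => k _; rewrite mulrCA; congr (_ * _).
  by rewrite !exprnP -expfzDr// addrC subrK.
(* One root more than the degree allows. *)
pose rs : seq R := [seq k.+2%:R | k <- iota 0 N.*2.+1].
have p0 : p = 0.
  apply: (@roots_geq_poly_eq0 _ p rs).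
  - apply/allP => _ /mapP[k _ ->]; apply/rootP; rewrite pE ?pnatr_eq0//.
    by rewrite a0 ?mulr0 ?pnatr_eq0 ?pnatr_eq1.
  - rewrite map_inj_uniq ?iota_uniq// => i j /eqP.
    by rewrite eqr_nat !eqSS => /eqP.
  - by rewrite size_map size_iota size_poly.
move=> k; have [kN|kN] := leqP (absz k) N; last exact: aN.
have kE : k = (absz (k + N%:Z))%:Z - N%:Z by lia.
have := coef_poly N.*2.+1 (fun k : nat => a (k%:Z - N%:Z)) (absz (k + N%:Z)).
have kl : (absz (k + N%:Z)%R < N.*2.+1)%N by lia.
by rewrite -/p p0 coef0 -kE kl => <-.
Qed.

Lemma symbol1 a : symbol a 1 = fsum a.
Proof. by apply: eq_fsbigr => k _; rewrite exp1rz mulr1. Qed.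

Lemma symbolN1 a : fsupp a ->
  symbol a (-1) = fsum (fun i => a (2 * i)) - fsum (fun i => a (2 * i + 1)).
Proof.
move=> fa; rewrite /symbol fsum_even_odd; last first.
  by apply: (fsupp_map (g := fun i t => t * (-1) ^ i)) fa => i; rewrite mul0r.
have N1 i : (-1 : R) ^ (2 * i) = 1 by rewrite -exprz_exp -exprnP sqrrN expr1n exp1rz.
congr (_ + _); first by apply: eq_fsbigr => i _; rewrite N1 mulr1.
rewrite -[RHS]mulN1r -(@fsumZ _ (fun i => a (2 * i + 1))).
  apply: eq_fsbigr => i _.
  by rewrite expfzDr ?oppr_eq0 ?oner_eq0// N1 mul1r expr1z mulrC.
by apply: (fsupp_comp (h := fun i => 2 * i + 1) (g := fun=> id) (K := 1)) fa => // i; lia.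
Qed.

Lemma ord2P (i : 'I_2) : i = 0 \/ i = 1.
Proof.
by case: (unliftP 0 i) => [k ->|->]; [right; rewrite (ord1 k); apply: val_inj|left].
Qed.

Lemma mx2P (M N : 'M[R]_2) : M 0 0 = N 0 0 -> M 0 1 = N 0 1 -> M 1 0 = N 1 0 ->
  M 1 1 = N 1 1 -> M = N.
Proof.
by move=> *; apply/matrixP => i j; case: (ord2P i) => ->; case: (ord2P j) => ->.
Qed.

Lemma vec2P (x y : 'cV[R]_2) : x 0 0 = y 0 0 -> x 1 0 = y 1 0 -> x = y.
Proof. by move=> *; apply/colP => i; case: (ord2P i) => ->. Qed.

Lemma mx22E (a b c d : R) : ((mx22 a b c d) 0 0 = a) * ((mx22 a b c d) 0 1 = b) *
  ((mx22 a b c d) 1 0 = c) * ((mx22 a b c d) 1 1 = d).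
Proof. by rewrite !mxE. Qed.

Lemma vec2E (a b : R) : ((vec2 a b) 0 0 = a) * ((vec2 a b) 1 0 = b).
Proof. by rewrite !mxE. Qed.

Lemma invmx_unique (M N : 'M[R]_2) : M *m N = 1%:M -> M \in unitmx /\ invmx M = N.
Proof.
by move=> MN; have [uM _] := mulmx1_unit MN; split=> //; rewrite -[RHS](mulKmx uM) MN mulmx1.
Qed.

Lemma lower_inv (y : R) : mx22 1 0 y 1 \in unitmx /\ invmx (mx22 1 0 y 1) = mx22 1 0 (- y) 1.
Proof. by apply: invmx_unique; apply: mx2P; rewrite mul_mxE !mx22E !mxE /=; ring. Qed.

Lemma swap_inv (s t : R) : s != 0 -> t != 0 ->
  mx22 0 t s 0 \in unitmx /\ invmx (mx22 0 t s 0) = mx22 0 s^-1 t^-1 0.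
Proof.
by move=> s0 t0; apply: invmx_unique; apply: mx2P; rewrite mul_mxE !mx22E !mxE /=; field.
Qed.

Lemma is_maskP A : is_mask A <-> fsupp A.
Proof. exact: fsuppP. Qed.

Lemma fsupp_entry A i j : fsupp A -> fsupp (entry A i j).
Proof. by apply: (fsupp_map (g := fun _ (M : 'M[R]_2) => M i j)) => k; rewrite mxE. Qed.

Lemma fsupp_mx A : (forall i j, fsupp (entry A i j)) -> fsupp A.
Proof.
move=> fA; have [[N0 h0] [N1 h1] [N2 h2] [N3 h3]] := And4 (fA 0 0) (fA 0 1) (fA 1 0) (fA 1 1).
by exists (N0 + N1 + N2 + N3)%N => k kN; apply: mx2P; rewrite [RHS]mxE;
  [apply: h0|apply: h1|apply: h2|apply: h3]; lia.
Qed.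

Lemma fsum_entry A i j : fsupp A -> (fsum A) i j = fsum (entry A i j).
Proof.
move=> fA; rewrite -(fsum_morph (phi := fun M : 'M[R]_2 => M i j))//.
by move=> x y; rewrite mxE.
Qed.

Lemma fsupp_lin a b x y : fsupp a -> fsupp b -> fsupp (fun k => x * a k + y * b k).
Proof.
have fx (c : int -> R) (t : R) : fsupp c -> fsupp (fun i => t * c i).
  by apply: (fsupp_map (g := fun i s => t * s)) => i; rewrite mulr0.
by move=> fa fb; apply: fsuppD; apply: fx.
Qed.

Lemma fsum_lin a b x y : fsupp a -> fsupp b ->
  fsum (fun k => x * a k + y * b k) = x * fsum a + y * fsum b.
Proof. by move=> fa fb; rewrite -!symbol1 symbol_lin. Qed.

Lemma fsupp_conj Q A : fsupp A -> fsupp (conj_mask Q A).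
Proof.
by apply: (fsupp_map (g := fun _ M => invmx Q *m M *m Q)) => k; rewrite mulmx0 mul0mx.
Qed.

Lemma conj_mask_mul Q Z A : Q \in unitmx -> Z \in unitmx ->
  conj_mask (Q *m Z) A = conj_mask Z (conj_mask Q A).
Proof.
move=> uQ uZ; apply/funext => k; rewrite /conj_mask.
suff -> : invmx (Q *m Z) = invmx Z *m invmx Q by rewrite !mulmxA.
by have [] := @invmx_unique (Q *m Z) (invmx Z *m invmx Q); rewrite ?mulmxA ?mulmxK ?mulmxV.
Qed.

Lemma conj_maskK Q A : Q \in unitmx -> conj_mask Q (conj_mask (invmx Q) A) = A.
Proof.
by move=> uQ; apply/funext => k; rewrite /conj_mask invmxK !mulmxA mulVmx// mul1mx mulmxKV.
Qed.

Lemma conj_maskVK Q A : Q \in unitmx -> conj_mask (invmx Q) (conj_mask Q A) = A.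
Proof.
by move=> uQ; rewrite -{2}(invmxK Q) conj_maskK// unitmx_inv.
Qed.

Lemma conj_maskE Q A k : Q \in unitmx -> Q *m conj_mask Q A k = A k *m Q.
Proof. by move=> uQ; rewrite /conj_mask !mulmxA mulmxV// mul1mx. Qed.

Lemma conj_lowerE y A k (B := conj_mask (mx22 1 0 y 1) A k) :
  [/\ B 0 0 = A k 0 0 + y * A k 0 1, B 0 1 = A k 0 1,
      B 1 0 = A k 1 0 + y * A k 1 1 - y * (A k 0 0 + y * A k 0 1) &
      B 1 1 = A k 1 1 - y * A k 0 1].
Proof.
by rewrite /B /conj_mask (lower_inv y).2 !mul_mxE !mx22E; split; ring.
Qed.

Lemma conj_swapE s t A k (B := conj_mask (mx22 0 t s 0) A k) : s != 0 -> t != 0 ->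
  [/\ B 0 0 = A k 1 1, B 0 1 = t / s * A k 1 0, B 1 0 = s / t * A k 0 1 & B 1 1 = A k 0 0].
Proof.
move=> s0 t0; rewrite /B /conj_mask (swap_inv s0 t0).2 !mul_mxE !mx22E.
by split; field; rewrite ?s0 ?t0.
Qed.

End Algebra.

(** * The mask relation behind the integral operator *)

Section Masks.
Variable R : realType.
Implicit Types (a b : int -> R) (A B C X V : mseq R).

Lemma symbol_ext a b : fsupp a -> fsupp b ->
  (forall k, a k = b k) <-> (forall z, z != 0 -> z != 1 -> symbol a z = symbol b z).
Proof.
move=> fa fb; split=> [ab z _ _|ab k]; first by rewrite (funext ab).
apply/eqP; rewrite -subr_eq0 -[a k]mul1r -[- b k]mulN1r; apply/eqP.
apply: (@symbol_eq0 _ (fun k => 1 * a k + -1 * b k)); first exact: fsupp_lin.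
by move=> z z0 z1; rewrite symbol_lin// ab// mul1r mulN1r subrr.
Qed.

(** This is L(z) X(z) = 1/2 V(z) L(z^2) with L = diag(1, z^-1 - 1), except that the
common factor z^-1 - 1 is cancelled in the last entry.  All terms have the shape
x a + y b so that [symbol_lin] and [fsum_lin] apply to them directly. *)
Definition integral_relation V X : Prop :=
  [/\ forall k, X k 0 0 = 2^-1 * V k 0 0 + 0 * V k 0 0,
      forall k, X k 0 1 = 2^-1 * V (k + 2) 0 1 + - 2^-1 * V k 0 1,
      forall k, 1 * X (k + 1) 1 0 + -1 * X k 1 0 = 2^-1 * V k 1 0 + 0 * V k 1 0 &
      forall k, X k 1 1 = 2^-1 * V (k + 1) 1 1 + 2^-1 * V k 1 1].

Lemma integral_relation_symbol V X : fsupp V -> fsupp X ->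
  integral_relation V X <-> forall z, z != 0 -> z != 1 ->
    [/\ symbol (entry X 0 0) z = 2^-1 * symbol (entry V 0 0) z,
        symbol (entry X 0 1) z = 2^-1 * ((z ^- 2 - 1) * symbol (entry V 0 1) z),
        symbol (entry X 1 0) z = 2^-1 * (symbol (entry V 1 0) z / (z^-1 - 1)) &
        symbol (entry X 1 1) z = 2^-1 * ((z^-1 + 1) * symbol (entry V 1 1) z)].
Proof.
move=> fV fX.
have fe A i j m : fsupp A -> fsupp (fun k => entry A i j (k + m)).
  by move=> fA; apply: fsupp_shift; apply: fsupp_entry.
have fe0 A i j : fsupp A -> fsupp (entry A i j) by apply: fsupp_entry.
pose r00 k := 2^-1 * entry V 0 0 k + 0 * entry V 0 0 k.
pose r01 k := 2^-1 * entry V 0 1 (k + 2) + - 2^-1 * entry V 0 1 k.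
pose l10 k := 1 * entry X 1 0 (k + 1) + -1 * entry X 1 0 k.
pose r10 k := 2^-1 * entry V 1 0 k + 0 * entry V 1 0 k.
pose r11 k := 2^-1 * entry V 1 1 (k + 1) + 2^-1 * entry V 1 1 k.
have f00 : fsupp r00 by apply: fsupp_lin; auto.
have f01 : fsupp r01 by apply: fsupp_lin; auto.
have f10 : fsupp r10 by apply: fsupp_lin; auto.
have f11 : fsupp r11 by apply: fsupp_lin; auto.
have g10 : fsupp l10 by apply: fsupp_lin; auto.
have s00 z : symbol r00 z = 2^-1 * symbol (entry V 0 0) z.
  by rewrite symbol_lin ?mul0r ?addr0; auto.
have s10 z : symbol r10 z = 2^-1 * symbol (entry V 1 0) z.
  by rewrite symbol_lin ?mul0r ?addr0; auto.
have s01 z : z != 0 -> symbol r01 z = 2^-1 * ((z ^- 2 - 1) * symbol (entry V 0 1) z).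
  move=> z0; rewrite symbol_lin; auto; rewrite symbol_shift//; auto.
  by rewrite -exprnN; ring.
have s11 z : z != 0 -> symbol r11 z = 2^-1 * ((z^-1 + 1) * symbol (entry V 1 1) z).
  move=> z0; rewrite symbol_lin; auto; rewrite symbol_shift//; auto.
  by rewrite exprN1; ring.
have t10 z : z != 0 -> symbol l10 z = (z^-1 - 1) * symbol (entry X 1 0) z.
  move=> z0; rewrite symbol_lin; auto; rewrite symbol_shift//; auto.
  by rewrite exprN1; ring.
have z1' z : z != 0 -> z != 1 -> z^-1 - 1 != 0 :> R.
  by move=> z0 z1; rewrite subr_eq0 invr_eq1.
split=> [[h00 h01 h10 h11] z z0 z1|h].
  split.
  - by rewrite -s00; apply: (symbol_ext _ _).1 => //; auto.
  - by rewrite -s01//; apply: (symbol_ext _ _).1 => //; auto.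
  - rewrite mulrA -s10; apply: canRL (mulfK (z1' z z0 z1)) _.
    by rewrite mulrC -t10//; apply: (symbol_ext _ _).1 => //; auto.
  - by rewrite -s11//; apply: (symbol_ext _ _).1 => //; auto.
split.
- apply: (symbol_ext (fe0 X 0 0 fX) f00).2 => z z0 z1; rewrite s00.
  by have [] := h z z0 z1.
- apply: (symbol_ext (fe0 X 0 1 fX) f01).2 => z z0 z1; rewrite s01//.
  by have [] := h z z0 z1.
- apply: (symbol_ext g10 f10).2 => z z0 z1; rewrite s10 t10//.
  have [_ _ -> _] := h z z0 z1.
  by rewrite mulrCA; congr (_ * _); rewrite mulrC divfK// z1'.
- apply: (symbol_ext (fe0 X 1 1 fX) f11).2 => z z0 z1; rewrite s11//.
  by have [] := h z z0 z1.
Qed.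

Lemma constant_int (T : Type) (c : int -> T) : (forall i, c (i + 1) = c i) -> forall i, c i = c 0.
Proof.
move=> cS; elim/int_ind => // n <-; first by rewrite -[RHS]cS; congr c; lia.
by rewrite -[LHS]cS; congr c; lia.
Qed.

Lemma fsupp_constant_eq0 a : fsupp a -> (forall k, a (k + 1) = a k) -> forall k, a k = 0.
Proof.
move=> [N aN] aS k; rewrite (constant_int aS) -(constant_int aS N.+1%:Z).
by apply: aN; lia.
Qed.

Lemma integral_relation_unique V X Y : fsupp X -> fsupp Y ->
  integral_relation V X -> integral_relation V Y -> X = Y.
Proof.
move=> fX fY [x00 x01 x10 x11] [y00 y01 y10 y11]; apply/funext => k.
apply: mx2P; rewrite ?x00 ?y00 ?x01 ?y01 ?x11 ?y11//.
apply/eqP; rewrite -subr_eq0 -[X k 1 0]mul1r -[- Y k 1 0]mulN1r; apply/eqP.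
apply: (@fsupp_constant_eq0 (fun k => 1 * X k 1 0 + -1 * Y k 1 0)).
  by apply: (@fsupp_lin _ (entry X 1 0) (entry Y 1 0)); apply: fsupp_entry.
by move=> {}k; have := x10 k; rewrite -y10; lra.
Qed.

(** Only the lower left entry requires a division, by z^-1 - 1, which is possible
because the entry of V vanishes at 1. *)
Lemma integral_relation_exists V : fsupp V -> fsum (entry V 1 0) = 0 ->
  exists2 X, fsupp X & integral_relation V X.
Proof.
move=> fV V0.
have fe i j : fsupp (entry V i j) by apply: fsupp_entry.
have [||g fg gP] := @fsum_antidiff _ (fun k => 2^-1 * entry V 1 0 k + 0 * entry V 1 0 k).
- exact: fsupp_lin.
- by rewrite fsum_lin// V0 !mulr0 addr0.
exists (fun k => mx22 (2^-1 * V k 0 0 + 0 * V k 0 0)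
  (2^-1 * V (k + 2) 0 1 + - 2^-1 * V k 0 1) (g k) (2^-1 * V (k + 1) 1 1 + 2^-1 * V k 1 1)).
  apply: fsupp_mx => i j; rewrite /entry.
  case: (ord2P i) => ->; case: (ord2P j) => ->; under eq_fun do rewrite mx22E //.
  - exact: (fsupp_lin (a := entry V 0 0) (b := entry V 0 0)).
  - exact: (@fsupp_lin _ (fun k => entry V 0 1 (k + 2)) (entry V 0 1) _ _ (fsupp_shift 2 (fe 0 1)) (fe 0 1)).
  - exact: fg.
  - exact: (@fsupp_lin _ (fun k => entry V 1 1 (k + 1)) (entry V 1 1) _ _ (fsupp_shift 1 (fe 1 1)) (fe 1 1)).
split=> k; rewrite !mx22E//.
by rewrite mul1r mulN1r gP.
Qed.

End Masks.

(** * The integral operator on masks *)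

Section Operators.
Variable R : realType.
Implicit Types (a b : int -> R) (A B C X : mseq R).

Lemma EspaceP B (x : 'cV[R]_2) :
  reflect (even_sum B *m x = x /\ odd_sum B *m x = x) (x \in Espace B).
Proof.
rewrite /Espace memv_cap; apply: (iffP andP).
  by move=> [/fixedSpaceP + /fixedSpaceP]; rewrite !lfunE.
by move=> [h1 h2]; split; apply/fixedSpaceP; rewrite lfunE.
Qed.

Lemma leigenspaceP (M : 'M[R]_2) x (la : R) :
  reflect (M *m x = la *: x) (x \in passmx.leigenspace (mxend M) la).
Proof.
rewrite /passmx.leigenspace memv_ker add_lfunE opp_lfunE scale_lfunE id_lfunE lfunE subr_eq0.
exact: eqP.
Qed.

Lemma row_mx2E (v q : 'cV[R]_2) i :
  ((row_mx v q : 'M[R]_2) i 0 = v i 0) * ((row_mx v q : 'M[R]_2) i 1 = q i 0).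
Proof.
split.
  transitivity (row_mx v q i (lshift 1 (0 : 'I_1))); last exact: row_mxEl.
  by congr (row_mx v q i _); apply: val_inj.
transitivity (row_mx v q i (rshift 1 (0 : 'I_1))); last exact: row_mxEr.
by congr (row_mx v q i _); apply: val_inj.
Qed.

Section I1.
Variable V : mseq R.
Hypothesis fV : fsupp V.
Hypothesis EV : forall x, (x \in Espace V) = (x 0 0 == 0).
Hypothesis V2 : (fsum V) 0 0 != 2.

Let a0 : R := (fsum V) 0 0.
Let y := (fsum V) 1 0 / (a0 - 2).
Let W := mx22 1 0 y 1.

Lemma a02 : a0 - 2 != 0. Proof. by rewrite subr_eq0. Qed.

Lemma sum_even_odd : fsum V = even_sum V + odd_sum V.
Proof. exact: fsum_even_odd. Qed.

(** The second basis vector is fixed by both sums. *)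
Lemma second_column (r : int) : r = 0 \/ r = 1 ->
  (fsum (fun i => V (2 * i + r))) 0 1 = 0 /\ (fsum (fun i => V (2 * i + r))) 1 1 = 1.
Proof.
have : vec2 0 1 \in Espace V by rewrite EV vec2E.
move=> /EspaceP[he ho].
have h (M : 'M[R]_2) : M *m vec2 0 1 = vec2 0 1 -> M 0 1 = 0 /\ M 1 1 = 1.
  move=> /colP ME; have := ME 0; have := ME 1.
  by rewrite !mul_mxvE !vec2E !mulr0 !mulr1 !add0r.
case=> ->; last by apply: h ho.
by apply: h; under eq_fsbigr do rewrite addr0.
Qed.

Lemma sum_second_column : (fsum V) 0 1 = 0 /\ (fsum V) 1 1 = 2.
Proof.
have [ev1 ev2] := second_column (or_introl erefl).
have [od1 od2] := second_column (or_intror erefl).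
rewrite fsum_even_odd// !mxE od1 od2.
under eq_fsbigr do rewrite -[2 * _]addr0.
by rewrite ev1 ev2 addr0.
Qed.

Lemma Espace_line v : Espace V = <[v]>%VS -> exists2 s, s != 0 & v = vec2 0 s.
Proof.
move=> Ev; have : v \in Espace V by rewrite Ev memv_line.
rewrite EV => /eqP v0; exists (v 1 0); last by apply: vec2P; rewrite vec2E.
apply/eqP => v1; have : vec2 0 1 \in Espace V by rewrite EV vec2E.
have vz : v = 0 by apply: vec2P; rewrite mxE.
rewrite Ev vz => /vlineP[k]; rewrite scaler0 => /colP /(_ 1); rewrite vec2E mxE => /eqP.
by rewrite oner_eq0.
Qed.

Lemma Espace_vec2 : Espace V = <[vec2 0 1]>%VS.
Proof.
apply/vspaceP => x; rewrite EV; apply/eqP/vlineP => [x0|[k ->]].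
  by exists (x 1 0); apply: vec2P; rewrite mxE vec2E ?mulr0 ?mulr1.
by rewrite mxE vec2E mulr0.
Qed.

Lemma mean_eigen (x : 'cV[R]_2) (la : R) : mean_mx V *m x = la *: x <->
  a0 * x 0 0 = 2 * la * x 0 0 /\ (fsum V) 1 0 * x 0 0 + 2 * x 1 0 = 2 * la * x 1 0.
Proof.
have [V01 V11] := sum_second_column.
rewrite /mean_mx -sum_even_odd -scalemxAl.
split=> [/colP h|[h0 h1]].
  have := h 0; have := h 1; rewrite [LHS]mxE [RHS]mxE mul_mxvE V11 => h1; rewrite [LHS]mxE [RHS]mxE mul_mxvE V01 -/a0 => h0.
  by split; lra.
by apply: vec2P; rewrite [LHS]mxE [RHS]mxE mul_mxvE ?V01 ?V11 -/a0; lra.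
Qed.

(** The sum of V is lower triangular with eigenvalues a0 and 2, and (1, y) is its
eigenvector for a0.  Only the scaling of the two columns is free. *)
Lemma canonicalP Q : canonical_transformation V Q <->
  exists s t, [/\ s != 0, t != 0 & Q = W *m mx22 0 t s 0].
Proof.
have QE s t : W *m mx22 0 t s 0 = row_mx (vec2 0 s) (vec2 t (t * y)).
  by apply: mx2P; rewrite row_mx2E mul_mxE !mx22E vec2E; ring.
split=> [[v [q [-> Ev q0 [la la1 Eq]]]]|[s [t [s0 t0 ->]]]].
  have [s s0 ->] := Espace_line Ev.
  have : q \in <[q]>%VS by rewrite memv_line.
  rewrite -Eq => /leigenspaceP /mean_eigen[h0 h1].
  have t0 : q 0 0 != 0.
    apply: contra q0 => /eqP t0; apply/eqP; apply: vec2P; rewrite mxE//.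
    move: h1; rewrite t0 mulr0 add0r => /eqP; rewrite -subr_eq0 -mulrBl mulf_eq0.
    by rewrite -{1}[2]mulr1 -mulrBr mulf_eq0 pnatr_eq0 /= subr_eq0 eq_sym (negPf la1) => /eqP.
  exists s, (q 0 0); split=> //; rewrite QE.
  suff <- : q = vec2 (q 0 0) (q 0 0 * y) by [].
  apply: vec2P; rewrite vec2E//.
  have laE : 2 * la = a0 by apply/esym/(mulIf t0).
  rewrite laE in h1; apply: (mulIf a02).
  by rewrite /y mulrA divfK ?a02// mulrBr; lra.
exists (vec2 0 s), (vec2 t (t * y)); split; first exact: QE.
- rewrite Espace_vec2; apply/vspaceP => x; apply/vlineP/vlineP => -[k ->].
    by exists (k / s); apply: vec2P; rewrite mxE vec2E mxE vec2E ?mulr0// divfK// mulr1.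
  by exists (k * s); apply: vec2P; rewrite mxE vec2E mxE vec2E ?mulr0// mulr1.
- by apply/eqP => /colP /(_ 0); rewrite vec2E mxE => /eqP; rewrite (negPf t0).
exists (a0 / 2).
  by apply/eqP => h; have := a02; rewrite subr_eq0 => /eqP; apply; lra.
apply/vspaceP => x; apply/leigenspaceP/vlineP => [/mean_eigen[_ h1]|[k ->]].
  exists (x 0 0 / t); apply: vec2P; rewrite mxE vec2E ?divfK// mulrA divfK//.
  apply: (mulIf a02); rewrite /y mulrA divfK ?a02//.
  by move: h1; rewrite mulrC mulrBr; lra.
apply/mean_eigen; rewrite !mxE /=; split; first by field.
by rewrite /y; field; rewrite a02.
Qed.


Lemma swap_symbol s t Y z (Z := mx22 0 t s 0 : 'M[R]_2) : s != 0 -> t != 0 -> fsupp Y ->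
  [/\ symbol (entry (conj_mask Z Y) 0 0) z = symbol (entry Y 1 1) z,
      symbol (entry (conj_mask Z Y) 0 1) z = t / s * symbol (entry Y 1 0) z,
      symbol (entry (conj_mask Z Y) 1 0) z = s / t * symbol (entry Y 0 1) z &
      symbol (entry (conj_mask Z Y) 1 1) z = symbol (entry Y 0 0) z].
Proof.
move=> s0 t0 fY.
have ZE k := conj_swapE Y k s0 t0.
have sZ c i j : symbol (fun k => c * entry Y i j k + 0 * entry Y i j k) z
    = c * symbol (entry Y i j) z.
  by rewrite symbol_lin ?mul0r ?addr0//; apply: fsupp_entry.
split; rewrite -?sZ; congr (symbol _ z); apply/funext => k; rewrite /entry ?mul0r ?addr0;
  by case: (ZE k).
Qed.

(** The scalings s and t multiply both sides of the off-diagonal relations by the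
same factor and drop out; this is why I1 does not depend on the canonical
transformation. *)
Lemma swap_symbol_relation s t Y X z (Z := mx22 0 t s 0 : 'M[R]_2) :
  s != 0 -> t != 0 -> fsupp Y -> fsupp X ->
  (let b i j := symbol (entry (conj_mask Z Y) i j) in
   mxsymbol (conj_mask Z X) z = 2^-1 *:
     mx22 ((z^-1 + 1) * b 0 0 z) (b 0 1 z / (z^-1 - 1))
          ((z ^- 2 - 1) * b 1 0 z) (b 1 1 z)) <->
  [/\ symbol (entry X 0 0) z = 2^-1 * symbol (entry Y 0 0) z,
      symbol (entry X 0 1) z = 2^-1 * ((z ^- 2 - 1) * symbol (entry Y 0 1) z),
      symbol (entry X 1 0) z = 2^-1 * (symbol (entry Y 1 0) z / (z^-1 - 1)) &
      symbol (entry X 1 1) z = 2^-1 * ((z^-1 + 1) * symbol (entry Y 1 1) z)].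
Proof.
move=> s0 t0 fY fX /=.
have [y00 y01 y10 y11] := swap_symbol z s0 t0 fY.
have [x00 x01 x10 x11] := swap_symbol z s0 t0 fX.
rewrite y00 y01 y10 y11; have ts : t / s != 0 by rewrite mulf_neq0 ?invr_neq0.
have st : s / t != 0 by rewrite mulf_neq0 ?invr_neq0.
have sE M i j : (mxsymbol M z : 'M[R]_2) i j = symbol (entry M i j) z by rewrite mxE.
split=> [/matrixP h|[h00 h01 h10 h11]].
  have g i j : symbol (entry (conj_mask Z X) i j) z = _ := etrans (esym (sE _ i j)) (h i j).
  split.
  - by rewrite -x11 g mxE mx22E.
  - by apply: (mulfI st); rewrite -x10 g mxE mx22E; ring.
  - by apply: (mulfI ts); rewrite -x01 g mxE mx22E; ring.
  - by rewrite -x00 g mxE mx22E.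
apply: mx2P; rewrite sE mxE mx22E.
- by rewrite x00 h11.
- by rewrite x01 h10; ring.
- by rewrite x10 h01; ring.
- by rewrite x11 h00.
Qed.

Lemma I1_specP X : vector_convergent V ->
  I1_spec V X <-> fsupp X /\ integral_relation (conj_mask W V) (conj_mask W X).
Proof.
move=> cV; have [uW _] := lower_inv y.
split=> [[_ _ _ [Q [Abar [/canonicalP[s [t [s0 t0 ->]]] /is_maskP fA -> h]]]]|[fX h]].
  have [uZ _] := swap_inv s0 t0.
  have uQ : W *m mx22 0 t s 0 \in unitmx by rewrite unitmx_mul uW uZ.
  split; first exact: fsupp_conj.
  set X' := conj_mask _ Abar; have fX' : fsupp X' by exact: fsupp_conj.
  have AE : Abar = conj_mask (mx22 0 t s 0) (conj_mask W X').
    by rewrite -conj_mask_mul// /X' conj_maskK.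
  apply/integral_relation_symbol; try exact: fsupp_conj.
  move=> z z0 z1; apply/(swap_symbol_relation _ s0 t0); try exact: fsupp_conj.
  by rewrite -AE -conj_mask_mul//; exact: h.
split.
- exact/is_maskP.
- exact: cV.
- rewrite Espace_vec2 dim_vline; case: eqP => // /colP /(_ 1).
  by rewrite vec2E mxE => /eqP; rewrite oner_eq0.
have n1 : 1 != 0 :> R := oner_neq0 _.
have [uZ _] := swap_inv n1 n1.
have uQ : W *m mx22 0 1 1 0 \in unitmx by rewrite unitmx_mul uW uZ.
exists (W *m mx22 0 1 1 0), (conj_mask (W *m mx22 0 1 1 0) X); split.
- by apply/canonicalP; exists 1, 1.
- exact/is_maskP/fsupp_conj.
- by rewrite conj_maskVK.
move=> b z z0 z1; rewrite /b !conj_mask_mul//.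
apply/(swap_symbol_relation _ n1 n1); try exact: fsupp_conj.
move: z z0 z1; apply/integral_relation_symbol => //; exact: fsupp_conj.
Qed.

(** The role of y: conjugation by W diagonalises the sum of V. *)
Lemma corner_zero : fsum (entry (conj_mask W V) 1 0) = 0.
Proof.
have [V01 V11] := sum_second_column.
rewrite -fsum_entry; last exact: fsupp_conj.
have -> : fsum (conj_mask W V) = conj_mask W (fun=> fsum V) 0.
  by apply: (@fsum_morph _ _ V (fun M => invmx W *m M *m W)) => // A B; rewrite mulmxDr mulmxDl.
have [_ _ -> _] := conj_lowerE y (fun=> fsum V) 0.
rewrite V01 V11 -/a0 mulr0 addr0 /y; have := a02; rewrite /y => a02'; field.
exact: a02'.
Qed.

Lemma I1_unique : vector_convergent V -> unique (I1_spec V) (I1 V).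
Proof.
move=> cV; have [uW _] := lower_inv y.
have [X' fX' hX'] := integral_relation_exists (fsupp_conj W fV) corner_zero.
have h0 : I1_spec V (conj_mask (invmx W) X').
  by apply/I1_specP => //; split; [exact: fsupp_conj|rewrite conj_maskK].
have h1 : I1_spec V (I1 V) by apply: (@xgetPex _ (fun=> 0) [set X | I1_spec V X]); eexists; exact: h0.
split=> // X /(I1_specP _ cV)[fX hX]; move: h1 => /(I1_specP _ cV)[fI hI].
rewrite -(conj_maskVK (I1 V) uW) -(conj_maskVK X uW); congr conj_mask.
by apply: integral_relation_unique hI hX; exact: fsupp_conj.
Qed.

End I1.
End Operators.

(** * The Taylor operator and its inverse on masks *)

Section Taylor.
Variable R : realType.
Implicit Types (a b : int -> R) (A B C X V : mseq R).

Lemma subdivDZ A (c d : vseq R) (x : R) : fsupp A ->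
  subdiv A (fun i => c i + x *: d i) = fun i => subdiv A c i + x *: subdiv A d i.
Proof.
move=> fA; transitivity (fun i => subdiv A c i + subdiv A (fun j => x *: d j) i).
  apply/funext => i; rewrite /subdiv -fsumD; try exact: fsupp_subdiv.
  by apply: eq_fsbigr => j _; rewrite mulmxDr.
by rewrite subdivZ.
Qed.

Lemma entryD m n (M N : 'M[R]_(m, n)) i j : (M + N) i j = M i j + N i j.
Proof. by rewrite mxE. Qed.

Lemma entryB m n (M N : 'M[R]_(m, n)) i j : (M - N) i j = M i j - N i j.
Proof. by rewrite !mxE. Qed.

Lemma entryZ m n (x : R) (M : 'M[R]_(m, n)) i j : (x *: M) i j = x * M i j.
Proof. by rewrite mxE. Qed.

Definition taylor1 : 'M[R]_2 := mx22 1 0 0 0.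
Definition taylor0 : 'M[R]_2 := mx22 (-1) (-1) 0 1.

Lemma taylorE (c : vseq R) : taylor c = stencil taylor1 taylor0 c.
Proof.
by apply/funext => i; apply: vec2P; rewrite /taylor /stencil vec2E mxE !mul_mxvE !mx22E; ring.
Qed.

Definition subsum A (r : int) : 'M[R]_2 := fsum (fun i => A (2 * i + r)).

Lemma fsupp_sub (U : zmodType) (f : int -> U) (r : int) : fsupp f -> fsupp (fun i => f (2 * i + r)).
Proof. by apply: (fsupp_comp (h := fun i => 2 * i + r) (g := fun=> id) (K := absz r)) => // i; lia. Qed.

Lemma subsum_entry A r i j : fsupp A -> subsum A r i j = fsum (fun k => entry A i j (2 * k + r)).
Proof. by move=> fA; rewrite /subsum fsum_entry//; apply: fsupp_sub. Qed.

Lemma subsum_total A : fsupp A -> fsum A = subsum A 0 + subsum A 1.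
Proof.
move=> fA; rewrite fsum_even_odd//; congr (_ + _).
by apply: eq_fsbigr => i _; rewrite addr0.
Qed.

Lemma sum_conj Q A : fsupp A -> fsum (conj_mask Q A) = conj_mask Q (fun=> fsum A) 0.
Proof.
by apply: (@fsum_morph _ _ A (fun M => invmx Q *m M *m Q)) => // M N; rewrite mulmxDr mulmxDl.
Qed.

Lemma subsum_conj Q A r : fsupp A -> subsum (conj_mask Q A) r = conj_mask Q (fun=> subsum A r) 0.
Proof. by move=> fA; apply: (@sum_conj Q (fun i => A (2 * i + r))); apply: fsupp_sub. Qed.

(** The values of a symbol at 1 and -1 are the sum and the difference of the even
and odd sums of its coefficients. *)
Lemma taylor_conditionsP B : fsupp B -> taylor_conditions B <->
  [/\ forall r : int, r = 0 \/ r = 1 -> subsum B r 0 1 = 0,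
      forall r : int, r = 0 \/ r = 1 -> subsum B r 1 1 = 1 &
      (fsum B) 0 0 + (fsum B) 1 0 = 2].
Proof.
move=> fB.
have s1 i j : symbol (entry B i j) 1 = subsum B 0 i j + subsum B 1 i j.
  by rewrite symbol1 -fsum_entry// subsum_total// mxE.
have sN1 i j : symbol (entry B i j) (-1) = subsum B 0 i j - subsum B 1 i j.
  rewrite symbolN1; last exact: fsupp_entry.
  by rewrite !subsum_entry//; congr (_ - _); apply: eq_fsbigr => k _; rewrite addr0.
rewrite /taylor_conditions !s1 !sN1 subsum_total// !mxE.
split=> [[[h1 h2] [h3 h4] h5]|[h1 h2 h3]].
  by split=> // r [] ->; lra.
have [h1' h1''] := (h1 0 (or_introl erefl), h1 1 (or_intror erefl)).
have [h2' h2''] := (h2 0 (or_introl erefl), h2 1 (or_intror erefl)).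
by do 2?split => //; lra.
Qed.

(** Solving T(z) C(z) = 1/2 B(z) T(z^2) entry by entry, only the upper right entry
of C needs a division, by z^-1 - 1; the Taylor conditions make the dividend vanish
at 1. *)
Lemma It_exists B : fsupp B -> taylor_conditions B ->
  exists C, It_spec B C /\ (fsum C) 0 0 = 2.
Proof.
move=> fB tB; have [t01 t11 t2] := (taylor_conditionsP fB).1 tB.
have fe i j : fsupp (entry B i j) by apply: fsupp_entry.
have feS i j m : fsupp (fun k => entry B i j (k + m)) by apply: fsupp_shift.
pose p k := 1 * entry B 0 0 k + 1 * entry B 1 0 k.
pose q k := 1 * entry B 0 1 k + 1 * entry B 1 1 k.
have fp : fsupp p by apply: fsupp_lin.
have fq : fsupp q by apply: fsupp_lin.
have fpS : fsupp (fun k => p (k + 1)) by apply: fsupp_shift.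
have sp : fsum p = 2 by rewrite fsum_lin// !mul1r -!fsum_entry.
have sq : fsum q = 2.
  rewrite fsum_lin// !mul1r -!fsum_entry// subsum_total// !mxE.
  by rewrite !t01 ?t11; auto; rewrite !addr0 !add0r.
have [||g fg gP] := @fsum_antidiff _ (fun k => 2^-1 * q k + - 2^-1 * p k).
- exact: fsupp_lin.
- by rewrite fsum_lin// sp sq; lra.
pose C k := mx22 (2^-1 * p (k + 1) + 2^-1 * p k) (g k)
  (2^-1 * entry B 1 0 (k + 2) + - 2^-1 * entry B 1 0 k)
  (2^-1 * entry B 1 1 k + - 2^-1 * entry B 1 0 k).
have fC : fsupp C.
  apply: fsupp_mx => i j; rewrite /entry /C.
  case: (ord2P i) => ->; case: (ord2P j) => ->; under eq_fun do rewrite mx22E //.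
  - exact: (fsupp_lin (a := fun k => p (k + 1)) (b := p)).
  - exact: fg.
  - exact: (fsupp_lin (a := fun k => entry B 1 0 (k + 2)) (b := entry B 1 0)).
  - exact: (fsupp_lin (a := entry B 1 1) (b := entry B 1 0)).
exists C; split.
  split=> //; [exact/is_maskP|exact/is_maskP|].
  move=> c; rewrite !taylorE; apply: stencil_subdiv => // k.
  have gk := gP k; rewrite /q /p /entry in gk.
  apply: mx2P; rewrite entryZ !entryD !mul_mxE !mx22E /p /entry;
    rewrite ?mulr0 ?mulr1 ?mul0r ?mul1r ?addr0 ?add0r ?mulrN1 ?mulN1r; try lra.
  have -> : k + 1 + 1 = k + 2 by lia.
  move: (B (k + 2) 0 0) (B (k + 2) 1 0) (B (k + 1) 0 0) (B (k + 1) 1 0) (B k 0 0) (B k 1 0) => *.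
  lra.
rewrite fsum_entry//.
transitivity (fsum (fun k => 2^-1 * p (k + 1) + 2^-1 * p k)).
  by apply: eq_fsbigr => k _; rewrite /entry mx22E.
by rewrite fsum_lin// fsum_shift sp; lra.
Qed.

(** Delta data recover all columns of a mask, and the Taylor operator is injective
on finitely supported sequences. *)
Lemma taylor_factor_unique B X Y : fsupp X -> fsupp Y ->
  taylor_factor X B -> taylor_factor Y B -> X = Y.
Proof.
move=> fX fY tX tY.
have dE (Z : mseq R) (x : 'cV[R]_2) i : subdiv Z (fun j => if j == 0 then x else 0) i = Z i *m x.
  rewrite /subdiv (fsum_single (i0 := 0)) => [|j j0]; first by rewrite mulr0 subr0 eqxx.
  by rewrite (negPf j0) mulmx0.
have tXY c : taylor (subdiv X c) = taylor (subdiv Y c) by rewrite tX tY.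
have col (x : 'cV[R]_2) k : X k *m x = Y k *m x.
  have h i := congr1 (@^~ i) (tXY (fun j => if j == 0 then x else 0)).
  have h1 i : (X i *m x) 1 0 = (Y i *m x) 1 0.
    by have /colP /(_ 1) := h i; rewrite /taylor !vec2E !dE.
  apply: vec2P; last exact: h1.
  pose d i := 1 * (X i *m x) 0 0 + -1 * (Y i *m x) 0 0.
  have fd (Z : mseq R) : fsupp Z -> fsupp (fun i => (Z i *m x) 0 0).
    by apply: (fsupp_map (g := fun _ (M : 'M[R]_2) => (M *m x) 0 0)) => _; rewrite mul0mx mxE.
  have d0 : d k = 0.
    apply: fsupp_constant_eq0; first by apply: fsupp_lin; apply: fd.
    move=> {}k; have /colP /(_ 0) := h k; rewrite /taylor !vec2E !dE (h1 k) /d; lra.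
  by move: d0; rewrite /d; lra.
apply/funext => k; apply: mx2P.
- by have /colP /(_ 0) := col (vec2 1 0) k; rewrite !mul_mxvE !vec2E !mulr1 !mulr0 !addr0.
- by have /colP /(_ 0) := col (vec2 0 1) k; rewrite !mul_mxvE !vec2E !mulr1 !mulr0 !add0r.
- by have /colP /(_ 1) := col (vec2 1 0) k; rewrite !mul_mxvE !vec2E !mulr1 !mulr0 !addr0.
- by have /colP /(_ 1) := col (vec2 0 1) k; rewrite !mul_mxvE !vec2E !mulr1 !mulr0 !add0r.
Qed.

Lemma It_unique B : fsupp B -> taylor_conditions B ->
  unique (It_spec B) (It B) /\ (fsum (It B)) 0 0 = 2.
Proof.
move=> fB tB; have [C [sC C2]] := It_exists fB tB.
have sI : It_spec B (It B) by apply: (@xgetPex _ (fun=> 0) [set X | It_spec B X]); exists C.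
have u X : It_spec B X -> It B = X.
  have [_ _ /is_maskP fI tI] := sI; move=> [_ _ /is_maskP fX tX].
  exact: taylor_factor_unique tI tX.
by split=> //; rewrite (u _ sC).
Qed.

(** T annihilates the constant sequence k and maps l to the constant (0, 1), which
S_B fixes.  As the kernel of T consists of the multiples of k, both S_C k and
S_C l - l / 2 are such multiples: the first factor is 1 because the upper left
entry of C sums to 2, and the second one is absorbed by the choice of phi. *)
Lemma It_spectral B C : fsupp B -> fsupp C -> taylor_conditions B -> taylor_factor C B ->
  (fsum C) 0 0 = 2 -> subsum C 0 0 0 = 1 /\ spectral_condition C.
Proof.
move=> fB fC tB tC C2; have [t01 t11 _] := (taylor_conditionsP fB).1 tB.
pose k : vseq R := fun=> vec2 1 0.
pose l0 : vseq R := fun i => vec2 i%:~R 1.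
have tk : taylor k = fun=> 0.
  by apply/funext => i; apply: vec2P; rewrite /taylor !vec2E mxE; ring.
have tl : taylor l0 = fun=> vec2 0 1.
  by apply/funext => i; apply: vec2P; rewrite /taylor !vec2E// intrD; ring.
have par (i : int) : exists m r : int, (r = 0 \/ r = 1) /\ i = 2 * m + r.
  by exists (i %/ 2)%Z, (i %% 2)%Z; lia.
have r01 (r : int) : r = 0 \/ r = 1 -> 0 <= r <= 1 by lia.
have Be i : subdiv B (fun=> vec2 0 1) i = vec2 0 1.
  have [m [r [hr ->]]] := par i; rewrite subdiv_cst//; last exact: r01.
  by apply: vec2P; rewrite mul_mxvE !vec2E mulr0 mulr1 add0r -/(subsum B r) ?t01 ?t11.
have Bz i : subdiv B (fun=> 0) i = 0 by apply: fsbig1 => j _; rewrite mulmx0.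
have hk i := congr1 (@^~ i) (tC k); have hl i := congr1 (@^~ i) (tC l0).
have Ck1 i : subdiv C k i 1 0 = 0.
  by have /colP /(_ 1) := hk i; rewrite /= {1}/taylor tk Bz vec2E scaler0 mxE.
have Cl1 i : subdiv C l0 i 1 0 = 2^-1.
  by have /colP /(_ 1) := hl i; rewrite /= {1}/taylor tl Be vec2E mxE vec2E mulr1.
have Ck0 i : subdiv C k i 0 0 = subdiv C k 0 0 0.
  apply: (constant_int (c := fun i => subdiv C k i 0 0)) => {}i.
  have /colP /(_ 0) := hk i; rewrite /= {1}/taylor tk Bz vec2E scaler0 mxE Ck1; lra.
have Cl0 i : subdiv C l0 i 0 0 - i%:~R / 2 = subdiv C l0 0 0 0 - 0%:~R / 2.
  apply: (constant_int (c := fun i => subdiv C l0 i 0 0 - i%:~R / 2)) => {}i.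
  have /colP /(_ 0) := hl i; rewrite /= {1}/taylor tl Be vec2E mxE vec2E mulr0 Cl1 intrD; lra.
have Cr (r : int) : r = 0 \/ r = 1 -> subdiv C k r 0 0 = subsum C r 0 0.
  move=> hr; have -> : r = 2 * 0 + r by lia.
  rewrite subdiv_cst//; last exact: r01.
  by rewrite mul_mxvE !vec2E mulr1 mulr0 addr0 mulr0 add0r.
have s0 := Cr 0 (or_introl erefl); have s1 := Cr 1 (or_intror erefl).
have C1 : subsum C 0 0 0 = 1.
  move: C2; rewrite subsum_total// mxE -s0 -s1 (Ck0 1); lra.
split=> //; pose phi := - 2 * (subdiv C l0 0 0 0 - 0%:~R / 2); exists phi.
have kk : subdiv C k = k.
  by apply/funext => i; apply: vec2P; rewrite vec2E ?Ck1// Ck0 s0.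
split=> //.
have -> : (fun i : int => vec2 (i%:~R + phi) 1) = (fun i => l0 i + phi *: k i).
  by apply/funext => i; apply: vec2P; rewrite entryD entryZ !vec2E ?mulr1 ?mulr0 ?addr0.
rewrite subdivDZ// kk; apply/funext => i; apply: vec2P; rewrite !entryZ !entryD !entryZ !vec2E.
  have := Cl0 i; rewrite /phi; lra.
by rewrite Cl1; lra.
Qed.

End Taylor.

(** * Smoothness, and integration of one component of a scheme *)

Section Smoothness.
Variable R : realType.

Lemma derive1n_entry k (f : R -> 'cV[R]_2) i :
  (forall j x, (j < k)%N -> derivable (derive1n j f) x 1) ->
  derive1n k (fun x => f x i 0 : R^o) = fun x => derive1n k f x i 0.
Proof.
elim: k => // k IH df.
have dk := df k _ (ltnSn k).
rewrite derive1nS IH => [|j x jk]; last by apply: df; apply: ltnW.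
by apply/funext => x; rewrite derive1nS !derive1E derive_mx ?mxE.
Qed.

Lemma Ck_entry k (f : R -> 'cV[R]_2) i : Ck k f -> Ck k (fun x => f x i 0 : R^o).
Proof.
move=> [df cf]; split=> [j x jk|].
  rewrite derive1n_entry => [|j' y j'j]; last by apply: df; apply: ltn_trans jk.
  by move: (df j x jk) => /derivable_mxP /(_ i 0).
rewrite derive1n_entry//.
move=> x; apply: (@continuous_comp _ _ _ (derive1n k f) (fun M : 'cV[R]_2 => M i 0)).
  exact: cf.
exact: coord_continuous.
Qed.

Lemma Ck_primitive k (F psi : R -> R^o) :
  (forall t, is_derive t (1 : R) F (psi t)) -> Ck k psi -> Ck k.+1 F.
Proof.
move=> dF [dpsi cpsi].
have F' : derive1 F = psi by apply/funext => t; rewrite derive1E derive_val.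
split=> [[|j] x jk|]; first by case: (dF x).
  by rewrite derive1Sn F'; apply: dpsi.
by rewrite derive1Sn F'.
Qed.

End Smoothness.

Section Component.
Variable R : realType.
Implicit Types (A B C X V : mseq R) (c : vseq R).

(** The coefficients of component r sum to 1, so that subtracting c i leaves only
differences of component r between neighbours at distance at most N, and values
of the other component. *)
Lemma subdiv_component X (r s : 'I_2) : fsupp X -> r != s -> subsum X 0 r r = 1 ->
  exists2 K, 0 <= K & forall c (e : R),
    (forall i, `|c i s 0| <= e) -> (forall i, `|c (i + 1) r 0 - c i r 0| <= e) ->
    forall i, `|subdiv X c (2 * i) r 0 - c i r 0| <= K * e.
Proof.
move=> [N XN] rs X1.
pose K := \sum_(k <- window N) mx_bound (X (2 * k)) * N.+1%:R.
exists K => [|c e cs cr i].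
  by rewrite sumr_ge0// => k _; rewrite mulr_ge0// mx_bound_ge0.
have e0 : 0 <= e by apply: le_trans (cs 0).
have far (k : nat) (j : int) : `|c (j + k%:Z) r 0 - c j r 0| <= k%:R * e.
  elim: k => [|k IH]; first by rewrite addr0 subrr normr0 mul0r.
  rewrite -(subrKA (c (j + k%:Z) r 0)) (le_trans (ler_normD _ _))//.
  rewrite -natr1 mulrDl mul1r addrC lerD//.
  by have -> : j + k.+1%:Z = j + k%:Z + 1 by lia.
have near (k j : int) : `|c (j - k) r 0 - c j r 0| <= (absz k)%:R * e.
  have [k0|k0] := leP 0 k.
    by have := far (absz k) (j - k); rewrite distrC (_ : j - k + _ = j)//; lia.
  by have := far (absz k) j; rewrite (_ : j + (absz k)%:Z = j - k)//; lia.
have mulE (M : 'M[R]_2) (x : 'cV[R]_2) : (M *m x) r 0 = M r r * x r 0 + M r s * x s 0.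
  rewrite mul_mxvE; move: rs; case: (ord2P r) => ->; case: (ord2P s) => -> //= _.
  by rewrite addrC.
have boundE (M : 'M[R]_2) : `|M r r| + `|M r s| <= mx_bound M.
  have -> : mx_bound M = (`|M 0 0| + `|M 0 1|) + (`|M 1 1| + `|M 1 0|).
    by rewrite /mx_bound -!addrA [`|M 1 1| + _]addrC.
  move: rs; case: (ord2P r) => ->; case: (ord2P s) => -> //= _.
    by rewrite lerDl addr_ge0.
  by rewrite lerDr addr_ge0.
have -> : 2 * i = 2 * i + 0 by rewrite addr0.
have r0 : 0 <= (0 : int) <= 1 by [].

rewrite (subdiv_window _ _ XN r0) summxE -[c i r 0 in X in _ - X]mul1r -X1.
rewrite /subsum (subsum_window XN r0) summxE mulr_suml -sumrB.
rewrite (le_trans (ler_norm_sum _ _ _))// mulr_suml big_seq [leRHS]big_seq ler_sum// => k.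
rewrite mem_window => kN; rewrite addr0 mulE addrAC -mulrBr -mulrA.
have kN' : (absz k)%:R <= N.+1%:R :> R by rewrite ler_nat; lia.
have N1 : 1 <= N.+1%:R :> R by rewrite ler1n.
rewrite (le_trans (ler_normD _ _))// !normrM.
apply: (@le_trans _ _ ((`|X (2 * k) r r| + `|X (2 * k) r s|) * (N.+1%:R * e))); last first.
  by rewrite ler_wpM2r// mulr_ge0.
rewrite [leRHS]mulrDl; apply: lerD; rewrite ler_wpM2l//.
  by apply: le_trans (near k i) _; rewrite ler_wpM2r.
by apply: le_trans (cs (i - k)) _; rewrite ler_peMl.
Qed.

(** One integration step.  The bound on component r comes from the same estimates as
its convergence, because the limit F is not known to be bounded beforehand. *)
Lemma integrated_component X (r s : 'I_2) (c : vseq R) (psi : R -> R) K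
    (x := fun n i => iter n (subdiv X) c i) :
  fsupp X -> r != s -> subsum X 0 r r = 1 -> continuous psi ->
  bounded_fun c ->
  (forall n i, `|x n i s 0| <= K / 2 ^+ n) ->
  (forall n i, `|x n (i + 1) r 0 - x n i r 0| <= K / 2 ^+ n) ->
  (forall e, 0 < e -> \forall n \near \oo, forall i : int,
     `|2 ^+ n * (x n (i + 1) r 0 - x n i r 0) - psi (i%:~R / 2 ^+ n)| <= e) ->
  (exists M, forall n i, `|x n i r 0| <= M) /\
  exists2 F : R -> R, forall t, is_derive t (1 : R) (F : R -> R^o) (psi t) &
    forall e, 0 < e -> \forall n \near \oo, forall i : int,
      `|x n i r 0 - F (i%:~R / 2 ^+ n)| <= e.
Proof.
move=> fX rs X1 cpsi /bounded_vseqP[M0 cM] xs xr dx.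
have [L L0 LP] := subdiv_component fX rs X1.
have K0 : 0 <= K by have := le_trans (normr_ge0 _) (xs 0%N 0); rewrite expr0 divr1.
have x2 n i : `|x n.+1 (2 * i) r 0 - x n i r 0| <= L * K / 2 ^+ n.
  by rewrite -mulrA; apply: LP; [apply: xs|apply: xr].
have LKn n : 0 <= L * K / 2 ^+ n by rewrite divr_ge0 ?mulr_ge0// exprn_ge0.
have Kn n : 0 <= K / 2 ^+ n by rewrite divr_ge0// exprn_ge0.
split.
  pose D := L * K + K.
  have step n i : exists j, `|x n.+1 i r 0| <= `|x n j r 0| + D / 2 ^+ n.
    have K2 : K / 2 ^+ n.+1 <= K / 2 ^+ n.
      by rewrite ler_wpM2l// lef_pV2 ?posrE ?exprn_gt0// ler_eXn2l ?ltr1n.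
    exists (i %/ 2)%Z; set j := (i %/ 2)%Z.
    have x2j := x2 n j; have xrj := xr n.+1 (2 * j).
    have nx : x n j r 0 <= `|x n j r 0| /\ - `|x n j r 0| <= x n j r 0.
      by rewrite ler_norm; split=> //; rewrite lerNl -normrN ler_norm.
    rewrite /D mulrDl; have Knn := Kn n; have LKnn := LKn n.
    have [iE|iE] : i = 2 * j \/ i = 2 * j + 1 by rewrite /j; lia.
      by rewrite iE; move: x2j; rewrite !ler_norml; lra.
    by rewrite iE; move: x2j xrj; rewrite !ler_norml; lra.
  have D0 : 0 <= D by rewrite addr_ge0 ?mulr_ge0.
  exists (M0 + 2 * D) => n i.
  (* The increments D / 2^k of the bound are summed geometrically. *)
  suff : `|x n i r 0| <= M0 + 2 * D - 2 * D / 2 ^+ n.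
    have : 0 <= 2 * D / 2 ^+ n by rewrite divr_ge0 ?mulr_ge0// exprn_ge0.
    by lra.
  elim: n i => [|n IH] i.
    by rewrite expr0 divr1 addrK; apply: le_trans (norm_entry _ _) (cM i).
  have [j /le_trans] := step n i; apply; have := IH j.
  have -> : 2 * D / 2 ^+ n.+1 = D / 2 ^+ n by rewrite exprS; field; rewrite expf_neq0.
  have -> : 2 * D / 2 ^+ n = D / 2 ^+ n + D / 2 ^+ n by rewrite -mulrA; ring.
  by lra.
apply: (@integration _ (fun n i => x n i r 0) psi (K + L * K)) => // n i.
  by apply: le_trans (xr n i) _; rewrite mulrDl lerDl.
by apply: le_trans (x2 n i) _; rewrite mulrDl lerDr.
Qed.

End Component.

(** * From the Taylor scheme to the Hermite scheme *)

Section Assembly.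
Variable R : realType.
Implicit Types (A B C X V : mseq R) (c : vseq R).

Lemma iter_conj Q A c n i : fsupp A -> Q \in unitmx ->
  Q *m iter n (subdiv (conj_mask Q A)) c i = iter n (subdiv A) (fun j => Q *m c j) i.
Proof.
move=> fA uQ.
have QE d : stencil 0 Q d = fun j => Q *m d j.
  by apply/funext => j; rewrite /stencil mul0mx add0r.
have hyp d : stencil 0 Q (subdiv (conj_mask Q A) d) = fun j => 1 *: subdiv A (stencil 0 Q d) j.
  apply: stencil_subdiv => //; first exact: fsupp_conj.
  by move=> k; rewrite !mul0mx mulmx0 !add0r scale1r conj_maskE.
have /(congr1 (@^~ i)) := stencil_iter fA hyp n c.
by rewrite !QE expr1n scale1r.
Qed.

Lemma stencil_bounded (G1 G0 : 'M[R]_2) c : bounded_fun c -> bounded_fun (stencil G1 G0 c).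
Proof.
move=> /bounded_vseqP[K cK]; apply/bounded_vseqP; exists (mx_bound G1 * K + mx_bound G0 * K) => i.
by rewrite /stencil (le_trans (ler_normD _ _))// lerD// (le_trans (norm_mulmx _ _))//
  ler_wpM2l// mx_bound_ge0.
Qed.

Lemma mulmx_bounded (Q : 'M[R]_2) c : bounded_fun c -> bounded_fun (fun i => Q *m c i).
Proof.
move=> bc; have := stencil_bounded 0 Q bc; congr bounded_fun.
by apply/funext => j; rewrite /stencil mul0mx add0r.
Qed.

(** A common fixed vector is, as a constant sequence, its own limit, so its first
component vanishes.  Conversely the values of a nonzero limit function are common
fixed vectors. *)
Lemma Espace_vanish V : fsupp V -> vector_convergent V ->
  (forall c Psi, bounded_fun c -> vector_limit V c Psi -> forall x : R, Psi x 0 0 = 0) ->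
  forall x : 'cV[R]_2, (x \in Espace V) = (x 0 0 == 0).
Proof.
move=> fV [cvg [c0 [Psi0 [bc0 lim0 nz0]]]] vanish x; apply/EspaceP/eqP => [[he ho]|x0].
  have hc : subdiv V (fun=> x) = fun=> x.
    apply/funext => i; have [m [r [hr ->]]] : exists m r : int, (r = 0 \/ r = 1) /\ i = 2 * m + r.
      by exists (i %/ 2)%Z, (i %% 2)%Z; lia.
    rewrite subdiv_cst//; last by lia.
    by case: hr => -> //; under eq_fsbigr do rewrite addr0.
  apply: (vanish (fun=> x) (fun=> x) _ _ 0); first by apply/bounded_vseqP; exists `|x|.
  split; first exact: cst_continuous.
  apply/converges_toP => e e0; apply: nearW => n i.
  have -> : iter n (subdiv V) (fun=> x) = fun=> x by elim: n => //= n ->.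
  by rewrite subrr normr0 ltW.
have [t Pt] : exists t, Psi0 t 1 0 != 0.
  apply/not_existsP => h; apply: nz0; apply/funext => t; apply: vec2P; rewrite mxE.
    exact: vanish bc0 lim0 t.
  by apply/eqP/negP; have := h t; move=> /negP; rewrite negbK => /eqP ->; rewrite eqxx.
have P0 := vanish _ _ bc0 lim0 t.
have xE : x = (x 1 0 / Psi0 t 1 0) *: Psi0 t.
  by apply: vec2P; rewrite entryZ ?P0 ?mulr0// divfK.
have f r := vector_limit_fixed fV t lim0 (r := r).
split; rewrite xE -scalemxAr; congr (_ *: _); last exact: f.
by rewrite -[RHS](f 0)//; congr (_ *m _); apply: eq_fsbigr => i _; rewrite addr0.
Qed.

Lemma integral_relation_stencil V' X c : fsupp V' -> fsupp X -> integral_relation V' X ->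
  stencil (mx22 0 0 0 1) (mx22 1 0 0 (-1)) (subdiv X c) =
  fun i => 2^-1 *: subdiv V' (stencil (mx22 0 0 0 1) (mx22 1 0 0 (-1)) c) i.
Proof.
move=> fV' fX [h00 h01 h10 h11]; apply: stencil_subdiv => // k.
apply: mx2P; rewrite entryZ !entryD !mul_mxE !mx22E.
- by rewrite !h00; ring.
- by rewrite !h01; ring.
- by have := h10 k; rewrite !mul0r !mul1r !mulr0 !mulr1 !addr0 !add0r !mulN1r.
rewrite !h11; have -> : k + 1 + 1 = k + 2 by lia.
by ring.
Qed.

Lemma vec_limit_components (w : nat -> vseq R) (Psi : R -> 'cV[R]_2) e : 0 < e ->
  converges_to w Psi -> \forall n \near \oo, forall i : int,
   `|w n i 0 0 - Psi (i%:~R / 2 ^+ n) 0 0| <= e /\ `|w n i 1 0 - Psi (i%:~R / 2 ^+ n) 1 0| <= e.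
Proof.
move=> e0 /converges_toP /(_ _ e0); apply: filterS => n h i; have := h i.
by rewrite (norm_vecP _ (ltW e0)) !entryB => /andP.
Qed.

Section Integrated.
Variable V : mseq R.
Hypothesis fV : fsupp V.
Hypothesis cV : vector_convergent V.
Hypothesis vanish : forall c Psi,
  bounded_fun c -> vector_limit V c Psi -> forall x : R, Psi x 0 0 = 0.
Variable y : R.
Let W : 'M[R]_2 := mx22 1 0 y 1.

(** First integration: the second component of the iterates of X converges to a
primitive of the second component of a limit function of V, while the first one is
O(2^-n). *)
Lemma integral_scheme X c : fsupp X -> integral_relation (conj_mask W V) X ->
  subsum X 0 1 1 = 1 -> bounded_fun c ->
  exists Psi d, [/\ bounded_fun d, vector_limit V d Psi,
    exists K, forall n i, `|iter n (subdiv X) c i 0 0| <= K / 2 ^+ n,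
    exists M, forall n i, `|iter n (subdiv X) c i 1 0| <= M &
    exists2 F : R -> R, forall t, is_derive t (1 : R) (F : R -> R^o) (Psi t 1 0) &
      forall e, 0 < e -> \forall n \near \oo, forall i : int,
        `|iter n (subdiv X) c i 1 0 - F (i%:~R / 2 ^+ n)| <= e].
Proof.
move=> fX hX X1 bc.
have [uW iW] := lower_inv y; rewrite -/W in uW iW.
have fV' : fsupp (conj_mask W V) by exact: fsupp_conj.
pose v0 := stencil (mx22 0 0 0 1) (mx22 1 0 0 (-1)) c.
pose w0 : vseq R := fun i => W *m v0 i.
have bw0 : bounded_fun w0 by apply: mulmx_bounded; apply: stencil_bounded.
have [Psi limPsi] := cV.1 w0 bw0.
have [L L0 LP] := scheme_bounded fV cV.1.
have [M0 M0P] := (bounded_vseqP w0).1 bw0.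
pose K0 := L * M0; have K0P n i : `|iter n (subdiv V) w0 i| <= K0 by exact: LP.
have K00 : 0 <= K0 by apply: le_trans (K0P 0%N 0).
exists Psi, w0.
pose p n := iter n (subdiv X) c; pose w n := iter n (subdiv V) w0.
have pw n : 0 < 2 ^+ n :> R by rewrite exprn_gt0.
have pE n i : p n i 0 0 = w n i 0 0 / 2 ^+ n /\
    p n (i + 1) 1 0 - p n i 1 0 = (w n i 1 0 - y * w n i 0 0) / 2 ^+ n.
  pose v := iter n (subdiv (conj_mask W V)) v0 i.
  have wv : w n i = W *m v by rewrite /w /w0 -iter_conj.
  have w0E : w n i 0 0 = v 0 0 by rewrite wv mul_mxvE !mx22E; ring.
  have w1E : w n i 1 0 = y * v 0 0 + v 1 0 by rewrite wv mul_mxvE !mx22E; ring.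
  have := stencil_iter fV' (fun d => integral_relation_stencil d fV' fX hX) n c.
  move=> /(congr1 (@^~ i)); rewrite /= -/v0 -/v exprVn /stencil -!/(p n) => /colP h.
  have := h 0; have := h 1; rewrite !entryD !entryZ !mul_mxvE !mx22E.
  rewrite !mul0r !mul1r !mulN1r !addr0 !add0r => h1 h0.
  by rewrite w0E w1E h0 h1 mulrC; split=> //; ring.
pose K := (1 + `|y|) * K0.
have K0K : K0 <= K by rewrite /K mulrDl mul1r lerDl mulr_ge0.
have xs n i : `|p n i 0 0| <= K / 2 ^+ n.
  rewrite (pE n i).1 normrM normfV (gtr0_norm (pw n)) ler_pM2r ?invr_gt0//.
  by rewrite (le_trans (norm_entry _ _))// (le_trans (K0P n i)).
have xr n i : `|p n (i + 1) 1 0 - p n i 1 0| <= K / 2 ^+ n.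
  rewrite (pE n i).2 normrM normfV (gtr0_norm (pw n)) ler_pM2r ?invr_gt0//.
  rewrite (le_trans (ler_normB _ _))// /K mulrDl mul1r normrM.
  by apply: lerD; [|apply: ler_wpM2l => //]; apply: le_trans (norm_entry _ _) (K0P n i).
have cpsi : continuous (fun t => Psi t 1 0).
  move=> x; apply: (@continuous_comp _ _ _ Psi (fun M : 'cV[R]_2 => M 1 0)).
    exact: limPsi.1.
  exact: coord_continuous.
have dx e : 0 < e -> \forall n \near \oo, forall i : int,
    `|2 ^+ n * (p n (i + 1) 1 0 - p n i 1 0) - Psi (i%:~R / 2 ^+ n) 1 0| <= e.
  move=> e0; pose e' := e / (1 + `|y|).
  have y1 : 0 < 1 + `|y| by rewrite ltr_pwDl.
  have e'0 : 0 < e' by rewrite divr_gt0.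
  have eE : e = e' + `|y| * e' by rewrite /e'; field; rewrite gt_eqF.
  apply: filterS (vec_limit_components e'0 limPsi.2) => n h i; have [h0 h1] := h i.
  rewrite (pE n i).2 mulrC divfK ?gt_eqF// addrAC eE -/(w n).
  rewrite (le_trans (ler_normB _ _))// lerD// normrM ler_wpM2l//.
  by move: h0; rewrite (vanish bw0 limPsi) subr0.
have [bM HF] := integrated_component fX (isT : (1 : 'I_2) != 0) X1 cpsi bc xs xr dx.
by split=> //; exists K.
Qed.

(** Second integration.  With g n = S_C^n c0 the Taylor operator gives
2^n Delta g_0 = b_0 + b_1 and 2^n g_1 = b_1, where b n is an iterate of B; both
right-hand sides converge uniformly to F. *)
Lemma hermite_limit X u C c0 : fsupp X -> integral_relation (conj_mask W V) X ->
  subsum X 0 1 1 = 1 -> fsupp C -> subsum C 0 0 0 = 1 ->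
  taylor_factor C (conj_mask (mx22 1 0 u 1) X) -> bounded_fun c0 ->
  exists Psi d (F F1 : R -> R), [/\ bounded_fun d, vector_limit V d Psi,
    forall t, is_derive t (1 : R) (F : R -> R^o) (Psi t 1 0),
    forall t, is_derive t (1 : R) (F1 : R -> R^o) (F t) &
    converges_to (hermite_iter C c0) (fun x => vec2 (F1 x) (F x))].
Proof.
move=> fX hX X1 fC C1 tC bc0.
set U := mx22 1 0 u 1 in tC; have [uU iU] := lower_inv u; rewrite -/U in uU iU.
have fB : fsupp (conj_mask U X) by exact: fsupp_conj.
pose d0 := taylor c0; pose p0 : vseq R := fun i => U *m d0 i.
have bp0 : bounded_fun p0.
  by apply: mulmx_bounded; rewrite /d0 taylorE; exact: stencil_bounded.
have [Psi [d [bd limPsi [K KP] [M MP] [F dF FP]]]] := integral_scheme fX hX X1 bp0.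
exists Psi, d, F.
pose g n := iter n (subdiv C) c0; pose p n := iter n (subdiv X) p0.
have pw n : 0 < 2 ^+ n :> R by rewrite exprn_gt0.
have K0 : 0 <= K by have := le_trans (normr_ge0 _) (KP 0%N 0); rewrite expr0 divr1.
have M0 : 0 <= M by exact: le_trans (MP 0%N 0).
have gE n i : g n i 1 0 = (p n i 1 0 - u * p n i 0 0) / 2 ^+ n /\
    g n (i + 1) 0 0 - g n i 0 0 = (p n i 0 0 + (p n i 1 0 - u * p n i 0 0)) / 2 ^+ n.
  pose b := iter n (subdiv (conj_mask U X)) d0 i.
  have pb : p n i = U *m b by rewrite /p /p0 -iter_conj.
  have p0E : p n i 0 0 = b 0 0 by rewrite pb mul_mxvE !mx22E; ring.
  have p1E : p n i 1 0 = u * b 0 0 + b 1 0 by rewrite pb mul_mxvE !mx22E; ring.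
  have hyp c : stencil (taylor1 R) (taylor0 R) (subdiv C c) =
      fun j => 2^-1 *: subdiv (conj_mask U X) (stencil (taylor1 R) (taylor0 R) c) j.
    by rewrite -!taylorE tC.
  have := stencil_iter fB hyp n c0; rewrite -!taylorE -/d0 => /(congr1 (@^~ i)).
  rewrite -/b exprVn /taylor -!/(g n) => /colP h.
  have := h 0; have := h 1; rewrite !entryZ !vec2E => h1 h0.
  have -> : g n (i + 1) 0 0 - g n i 0 0 = g n (i + 1) 0 0 - g n i 0 0 - g n i 1 0 + g n i 1 0.
    by rewrite subrK.
  by rewrite h0 h1 p0E p1E; split; ring.
have p0K n i : `|p n i 0 0| <= K.
  by apply: le_trans (KP n i) _; rewrite ler_pdivrMr// ler_peMr// exprn_ege1// ler1n.
have up n i : `|u * p n i 0 0| <= `|u| * K by rewrite normrM ler_wpM2l.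
pose K2 := K + (M + `|u| * K).
have xs n i : `|g n i 1 0| <= K2 / 2 ^+ n.
  rewrite (gE n i).1 normrM normfV (gtr0_norm (pw n)) ler_pM2r ?invr_gt0//.
  rewrite (le_trans (ler_normB _ _))// /K2 (le_trans (lerD (MP n i) (up n i)))//.
  by rewrite lerDr.
have xr n i : `|g n (i + 1) 0 0 - g n i 0 0| <= K2 / 2 ^+ n.
  rewrite (gE n i).2 normrM normfV (gtr0_norm (pw n)) ler_pM2r ?invr_gt0//.
  rewrite (le_trans (ler_normD _ _))// lerD// (le_trans (ler_normB _ _))// lerD//.
  exact: MP.
have cF : continuous F.
  move=> t; apply: differentiable_continuous; apply/derivable1_diffP.
  by case: (dF t).
have small e : 0 < e -> \forall n \near \oo, forall i : int,
    `|p n i 0 0| + `|p n i 1 0 - u * p n i 0 0 - F (i%:~R / 2 ^+ n)| <= e.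
  move=> e0; have e2 : 0 < e / 2 by rewrite divr_gt0.
  apply: filterS2 (pow2_small ((1 + `|u|) * K) e2) (FP _ e2) => n h1 h2 i.
  have q0 : `|p n i 0 0| + `|u * p n i 0 0| <= e / 2.
    apply: le_trans h1; rewrite normrM -{1}[`|_|]mul1r -mulrDl -mulrA ler_wpM2l ?addr_ge0//.
    exact: KP.
  rewrite addrAC (splitr e) (le_trans (lerD (lexx _) (ler_normB _ _)))//.
  by have := h2 i; rewrite -/(p n); lra.
have dx e : 0 < e -> \forall n \near \oo, forall i : int,
    `|2 ^+ n * (g n (i + 1) 0 0 - g n i 0 0) - F (i%:~R / 2 ^+ n)| <= e.
  move=> e0; apply: filterS (small e e0) => n h i; apply: le_trans (h i).
  by rewrite (gE n i).2 mulrC divfK ?gt_eqF// -addrA ler_normD.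
have [_ [F1 dF1 F1P]] := integrated_component fC (isT : (0 : 'I_2) != 1) C1 cF bc0 xs xr dx.
exists F1; split=> //.
have DE n : hermiteD R ^- n = mx22 1 0 0 (2 ^+ n).
  have DnE : hermiteD R ^+ n = mx22 1 0 0 (2 ^- n).
    elim: n => [|m IH]; first by apply: mx2P; rewrite expr0 !mxE /= ?invr1.
    rewrite exprS IH /hermiteD; apply: mx2P; rewrite mul_mxE !mx22E ?exprS ?invfM; ring.
  rewrite DnE; have [] := @invmx_unique R (mx22 1 0 0 (2 ^- n)) (mx22 1 0 0 (2 ^+ n)) => //.
  by apply: mx2P; rewrite mul_mxE !mx22E !mxE /=; field; rewrite ?expf_neq0.
apply/converges_toP => e e0.
apply: filterS2 (F1P e e0) (small e e0) => n h1 h2 i.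
rewrite /hermite_iter DE -/(g n) (norm_vecP _ (ltW e0)).
rewrite !entryB !mul_mxvE !mx22E !vec2E.
rewrite !mul0r !mul1r addr0 add0r (gE n i).1 [2 ^+ n * _]mulrC divfK ?gt_eqF//.
by rewrite h1 /= (le_trans _ (h2 i))// lerDr.
Qed.

End Integrated.

Section Transformed.
Variable V : mseq R.
Hypothesis fV : fsupp V.
Hypothesis cV : vector_convergent V.
Hypothesis EV : forall x, (x \in Espace V) = (x 0 0 == 0).
Hypothesis V2 : `|(fsum V) 0 0| < 2.

Let y : R := (fsum V) 1 0 / ((fsum V) 0 0 - 2).
Let W : 'M[R]_2 := mx22 1 0 y 1.

Lemma corner_neq2 : (fsum V) 0 0 != 2.
Proof. by apply/eqP => h; move: V2; rewrite h ger0_norm// ltxx. Qed.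

(** Since the sum of X is lower triangular with diagonal (a/2, 2), the sum of every
lower triangular conjugate of it has the same diagonal, and eta is the parameter
for which the first column adds up to 2.  The remaining Taylor conditions hold
for every such conjugate. *)
Lemma transformed_masks : exists X u,
  [/\ fsupp X, integral_relation (conj_mask W V) X, subsum X 0 1 1 = 1, tilde_dom (I1 V) &
      tilde (I1 V) = conj_mask (mx22 1 0 u 1) X /\ taylor_conditions (tilde (I1 V))].
Proof.
have V2' := corner_neq2.
have [hP _] := I1_unique fV EV V2' cV.
have [fP hX] := (I1_specP fV EV V2' _ cV).1 hP; rewrite -/y -/W in hX.
set P := I1 V in fP hX *; set X := conj_mask W P in hX.
have fX : fsupp X by exact: fsupp_conj.
have [uW iW] := lower_inv y; rewrite -/W in uW iW.
have PE : P = conj_mask (mx22 1 0 (- y) 1) X by rewrite -iW conj_maskVK.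
pose V' := conj_mask W V; have fV' : fsupp V' by exact: fsupp_conj.
have [hX00 hX01 hX10 hX11] := hX; rewrite -/V' in hX00 hX01 hX10 hX11.
have fe A i j : fsupp A -> fsupp (entry A i j) by exact: fsupp_entry.
have sV r : r = 0 \/ r = 1 -> subsum V' r 0 1 = 0 /\ subsum V' r 1 1 = 1.
  move=> hr; have [h01 h11] := second_column EV hr; rewrite -/(subsum V r) in h01 h11.
  rewrite subsum_conj//; have [_ -> _ ->] := conj_lowerE y (fun=> subsum V r) 0.
  by rewrite h01 h11 mulr0 subr0.
have sX01 (r : int) : r = 0 \/ r = 1 -> subsum X r 0 1 = 0.
  move=> hr; rewrite subsum_entry//.
  pose f k := entry V' 0 1 (2 * k + r).
  transitivity (fsum (fun k => 2^-1 * f (k + 1) + - 2^-1 * f k)).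
    apply: eq_fsbigr => k _; rewrite /f /entry hX01; congr (_ * V' _ _ _ + _); lia.
  have ff : fsupp f by apply: fsupp_sub; apply: fe.
  by rewrite fsum_lin ?fsum_shift//; [ring|exact: fsupp_shift].
have sX11 (r : int) : r = 0 \/ r = 1 -> subsum X r 1 1 = 1.
  move=> hr; rewrite subsum_entry//.
  pose f (r : int) k := entry V' 1 1 (2 * k + r).
  have ff r' : fsupp (f r') by apply: fsupp_sub; apply: fe.
  have f1 r' : r' = 0 \/ r' = 1 -> fsum (f r') = 1.
    by move=> hr'; rewrite -(sV r' hr').2 subsum_entry.
  transitivity (fsum (fun k => 2^-1 * f (r + 1) k + 2^-1 * f r k)).
    by apply: eq_fsbigr => k _; rewrite /f /entry hX11 addrA.
  rewrite fsum_lin// (f1 r)//; case: hr => ->.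
    by rewrite f1; [lra|right].
  have -> : f (1 + 1) = fun k => f 0 (k + 1).
    by apply/funext => k; rewrite /f; congr (entry _ _ _ _); lia.
  by rewrite fsum_shift f1; [lra|left].
have fsX01 : (fsum X) 0 1 = 0.
  by rewrite subsum_total// entryD !sX01 ?addr0; auto.
have fsX11 : (fsum X) 1 1 = 2.
  by rewrite subsum_total// entryD !sX11; auto.
have fsX00 : (fsum X) 0 0 = (fsum V) 0 0 / 2.
  rewrite fsum_entry//; transitivity (fsum (fun k => 2^-1 * entry V' 0 0 k + 0 * entry V' 0 0 k)).
    by apply: eq_fsbigr => k _; rewrite /entry hX00.
  rewrite fsum_lin; [|exact: fe|exact: fe].
  rewrite -fsum_entry// sum_conj//; have [-> _ _ _] := conj_lowerE y (fun=> fsum V) 0.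
  by rewrite (sum_second_column fV EV).1 mulr0 addr0 mul0r addr0 mulrC.
have [P00 P01 P10 P11] := conj_lowerE (- y) (fun=> fsum X) 0.
rewrite -sum_conj// -PE fsX01 fsX11 mulr0 addr0 in P00 P10.
have a4 : (fsum X) 0 0 != 2.
  apply/eqP; rewrite fsX00 => h; move: V2; have -> : (fsum V) 0 0 = 4 by lra.
  by rewrite ger0_norm// ltr_nat.
have s1 i j : symbol (entry P i j) 1 = (fsum P) i j by rewrite symbol1 fsum_entry.
pose eta := 1 + (fsum P) 1 0 / ((fsum P) 0 0 - 2).
exists X, (eta - y).
have BE : tilde P = conj_mask (mx22 1 0 (eta - y) 1) X.
  rewrite /tilde !s1 -/eta PE -conj_mask_mul ?(lower_inv _).1//.
  by congr conj_mask; apply: mx2P; rewrite mul_mxE !mx22E; ring.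
split=> //; first by apply: sX11; left.
  by rewrite /tilde_dom s1 P00.
split=> //; rewrite BE; apply/taylor_conditionsP; first exact: fsupp_conj.
split=> [r hr|r hr|].
- by rewrite subsum_conj//; have [_ -> _ _] := conj_lowerE (eta - y) (fun=> subsum X r) 0; exact: sX01.
- rewrite subsum_conj//; have [_ _ _ ->] := conj_lowerE (eta - y) (fun=> subsum X r) 0.
  by rewrite sX01// sX11// mulr0 subr0.
rewrite sum_conj//; have [-> _ -> _] := conj_lowerE (eta - y) (fun=> fsum X) 0.
rewrite fsX01 fsX11 /eta P00 P10; move: a4; rewrite -subr_eq0 => a4; field.
exact: a4.
Qed.

End Transformed.
End Assembly.

Theorem mainTheorem2 (R : realType) (l : nat) (A : int -> 'M[R]_2) :
  (1 <= l)%N ->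
  is_mask A ->
  spectral_condition A ->
  vector_Ck l.-1 (dt A) ->
  (forall (c0 : int -> 'cV[R]_2) (Psi : R -> 'cV[R]_2),
     bounded_fun c0 -> vector_limit (dt A) c0 Psi ->
     forall x : R, Psi x 0 0 = 0) ->
  let P := I1 (dt A) in
  let B := tilde P in
  let C := It B in
  [/\ unique (I1_spec (dt A)) P, tilde_dom P & unique (It_spec B) C] /\
  [/\ is_mask C, spectral_condition C & HCk l.+1 C].
Proof.
move=> l1 mA sA [cV smooth] vanish P B C.
set V := dt A in cV smooth vanish P B C *.
(* Outside its domain dt takes the value 0, which has finite support as well. *)
have fV : fsupp V.
  apply/is_maskP; rewrite /V /dt; case: xgetP => [X _ [_ _ fX _]//|_].
  by rewrite /is_mask (_ : [set i | _] = set0)//; apply/seteqP; split=> // i /=; rewrite eqxx.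
have EV := Espace_vanish fV cV vanish.
have V01 := (sum_second_column fV EV).1.
have V2 := contractive_corner fV cV.1 vanish V01.
have V2' := corner_neq2 V2.
have [X [u [fX hX X1 tP [BE tB]]]] := transformed_masks fV cV EV V2.
rewrite -/P -/B in tP BE tB.
have fB : fsupp B by rewrite BE; exact: fsupp_conj.
have [uC C2] := It_unique fB tB; rewrite -/C in uC C2.
have [[_ _ /is_maskP fC tC] _] := uC.
have [C1 sC] := It_spectral fB fC tB tC C2.
split; first by split=> //; exact: I1_unique.
split=> //; first exact/is_maskP.
move=> c0 bc0; rewrite BE in tC.
have [Psi [d [F [F1 [bd limPsi dF dF1 cvgF]]]]] :=
  hermite_limit fV cV vanish fX hX X1 fC C1 tC bc0.
have CPsi : Ck l.-1 (fun t => Psi t 1 0 : R^o) by apply: Ck_entry; apply: smooth bd limPsi.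
have CF : Ck l (F : R -> R^o) by rewrite -(prednK l1); apply: Ck_primitive dF CPsi.
exists F1; split; first exact: Ck_primitive dF1 CF.
by rewrite (_ : derive1 _ = F)//; apply/funext => t; rewrite derive1E derive_val.
Qed.
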